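(* Let $X$ be a complex infinite-dimensional Banach space, and let $\mathcal{I}$ be a non-zero, closed ideal of operators contained in the ideal $\mathcal{S}$ of strictly singular operators. Then $K_1(\mathcal{I}(X))=\{0\}$.
   Context: All Banach spaces are complex and infinite-dimensional; $\mathcal{B}(X,Y)$ is the Banach space of continuous linear maps $X\to Y$ and $\mathcal{B}(X)=\mathcal{B}(X,X)$. An ideal of operators $\mathcal{I}$ assigns to each pair $(X,Y)$ of Banach spaces a subspace $\mathcal{I}(X,Y)$ of $\mathcal{B}(X,Y)$ such that $TSR\in\mathcal{I}(W,Z)$ whenever $R\in\mathcal{B}(W,X)$, $S\in\mathcal{I}(X,Y)$, $T\in\mathcal{B}(Y,Z)$; write $\mathcal{I}(X)=\mathcal{I}(X,X)$. It is closed if every $\mathcal{I}(X,Y)$ is norm-closed, non-zero if $\mathcal{I}(X,Y)\neq\{0\}$ for all $X,Y$, and contained in $\mathcal{J}$ if $\mathcal{I}(X,Y)\subseteq\mathcal{J}(X,Y)$ for all $X,Y$. An operator $S:X\to Y$ is strictly singular ($S\in\mathcal{S}(X,Y)$) if every subspace of $X$ on which $S$ is bounded below is finite-dimensional. $K_1$: for a unital Banach algebra $A$, let $\operatorname{Inv}_n(A)$ be the group of invertible elements of $M_n(A)$ and $\operatorname{Inv}_\infty(A)=\bigcup_{n\ge 1}\operatorname{Inv}_n(A)$. For $U\in\operatorname{Inv}_m(A)$, $V\in\operatorname{Inv}_n(A)$ write $U\sim_1 V$ if for some $k>\max\{m,n\}$ there is a continuous path in $\operatorname{Inv}_k(A)$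 from $\operatorname{diag}(U,I^{(k-m)})$ to $\operatorname{diag}(V,I^{(k-n)})$, where $I^{(j)}$ is the identity of $M_j(A)$. Then $K_1(A)=\operatorname{Inv}_\infty(A)/{\sim_1}$, a commutative group under $[U]_1+[V]_1=[\operatorname{diag}(U,V)]_1$. For a non-unital Banach algebra $A$, $K_1(A):=K_1(A^\sharp)$, where $A^\sharp$ is $A$ with an identity adjoined; $\mathcal{I}(X)^\sharp$ is identified with $\mathcal{I}(X)+\mathbb{C}I\subseteq\mathcal{B}(X)$. *)

(* Defs.v *)
From HB Require Import structures.
From mathcomp Require Import all_boot all_order all_algebra.
From mathcomp Require Import all_classical all_reals all_analysis.
From mathcomp Require Import complex.

Set Implicit Arguments.
Unset Strict Implicit.
Unset Printing Implicit Defensive.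

Import Order.TTheory GRing.Theory Num.Theory.
Import numFieldTopology.Exports numFieldNormedType.Exports.

Local Open Scope classical_set_scope.
Local Open Scope complex_scope.
Local Open Scope ring_scope.

Definition is_subspace (K : numFieldType) (V : lmodType K) (E : set V) : Prop :=
  E 0 /\ forall (a : K) (x y : V), E x -> E y -> E (a *: x + y).

Definition finite_dimensional (K : numFieldType) (V : lmodType K)
    (E : set V) : Prop :=
  exists (n : nat) (e : 'I_n -> V),
    E = [set \sum_(i < n) a i *: e i | a in [set: 'I_n -> K]].

(* operator X Y is the space B(X, Y) of continuous linear maps. *)
Section Operators.
Context (K : numFieldType) (X Y : normedModType K).

Definition operator_pred : {pred X -> Y} :=
  [pred f | `[< linear f /\ continuous f >]].

Record operator := Operator {
  operator_fun :> X -> Y;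
  operatorP : operator_fun \in operator_pred }.

HB.instance Definition _ := [isSub for operator_fun].
HB.instance Definition _ := [Choice of operator by <:].

Fact operator_submod_closed : submod_closed operator_pred.
Proof.
split.
  apply/asboolP; split; first by move=> a x y; rewrite /= scaler0 addr0.
  by move=> x; exact: cvg_cst.
move=> a f g /asboolP[fl fc] /asboolP[gl gc]; apply/asboolP; split.
  move=> b x y; rewrite /= !fctE fl gl !scalerDr !scalerA [a * b]mulrC -!addrA.
  by congr (_ + _); rewrite !addrA; congr (_ + _); rewrite addrC.
move=> x; apply: cvgD; last exact: gc.
by apply: cvgZl_tmp; exact: fc.
Qed.

HB.instance Definition _ :=
  GRing.isSubmodClosed.Build K (X -> Y) operator_pred operator_submod_closed.
HB.instance Definition _ := [SubChoice_isSubLmodule of operator by <:].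

Fact operator_linear (T : operator) : linear T.
Proof. by case/asboolP: (operatorP T). Qed.

HB.instance Definition _ (T : operator) :=
  GRing.isLinear.Build K X Y _ T (operator_linear T).

Lemma operator_continuous (T : operator) : continuous T.
Proof. by case/asboolP: (operatorP T). Qed.

Lemma operator_ext (S T : operator) : S =1 T -> S = T.
Proof. by move=> ST; apply: val_inj; apply/funext. Qed.

End Operators.

Section OperatorNorm.
Context (R : realType) (X Y : normedModType R[i]).
Implicit Types S T : operator X Y.

(* Norms in a normedModType over R[i] take values in R[i] (they are nonnegative
   reals there), hence the real part under the supremum. *)
Definition opnorm T : R[i] :=
  (sup [set complex.Re `|T x| | x in [set x : X | `|x| <= 1]])%:C.

Let Re_norm (V : normedModType R[i]) (v : V) : (complex.Re `|v|)%:C = `|v|.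
Proof. by rewrite RRe_real// ger0_real. Qed.

Lemma operator_bound T : exists2 c : R, 0 <= c & forall x, `|T x| <= c%:C * `|x|.
Proof.
have /linear_bounded_continuous/linear_boundedP := @operator_continuous _ _ _ T.
move=> /pinfty_ex_gt0[c c0 cT]; exists (complex.Re c).
  by rewrite -lecR (RRe_real (gtr0_real c0)) ltW.
by move=> x; rewrite (RRe_real (gtr0_real c0)); exact: cT.
Qed.

Let opset T := [set complex.Re `|T x| | x in [set x : X | `|x| <= 1]].

Let opset_has_sup T : has_sup (opset T).
Proof.
split; first by exists (complex.Re `|T 0|); exists 0 => //=; rewrite normr0.
have [c c0 cT] := operator_bound T; exists c => _ [x /= x1 <-].
rewrite -lecR Re_norm (le_trans (cT x))//.
by rewrite -[leRHS]mulr1 ler_wpM2l ?lecR.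
Qed.

Lemma opnorm_ge0 T : 0 <= opnorm T.
Proof.
rewrite lecR; apply: le_trans (sup_upper_bound (opset_has_sup T) _).
  2: by exists 0 => //=; rewrite normr0.
by rewrite -lecR Re_norm; exact: normr_ge0.
Qed.

Lemma le_opnorm T x : `|T x| <= opnorm T * `|x|.
Proof.
have [->|x0] := eqVneq x 0; first by rewrite linear0 !normr0 mulr0.
have nx : 0 < `|x| by rewrite normr_gt0.
rewrite -ler_pdivrMr// mulrC.
have -> : `|x|^-1 * `|T x| = `|T (`|x|^-1 *: x)|.
  by rewrite linearZ normrZ ger0_norm// invr_ge0.
rewrite -Re_norm lecR; apply: (sup_upper_bound (opset_has_sup T)).
exists (`|x|^-1 *: x) => //=.
by rewrite normrZ ger0_norm ?invr_ge0// mulVf// gt_eqF.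
Qed.

Lemma opnorm_le T (c : R[i]) :
  0 <= c -> (forall x, `|T x| <= c * `|x|) -> opnorm T <= c.
Proof.
move=> c0 cT; rewrite -[leRHS]RRe_real ?ger0_real// lecR; apply: ge_sup.
  by case: (opset_has_sup T).
move=> _ [x /= x1 <-]; rewrite -lecR Re_norm RRe_real ?ger0_real//.
by rewrite (le_trans (cT x))// -[leRHS]mulr1 ler_wpM2l.
Qed.

Fact opnormD S T : opnorm (S + T) <= opnorm S + opnorm T.
Proof.
apply: opnorm_le => [|x]; first by rewrite addr_ge0 ?opnorm_ge0.
by rewrite (le_trans (ler_normD _ _))// mulrDl lerD ?le_opnorm.
Qed.

Let opnormZ_le a T : opnorm (a *: T) <= `|a| * opnorm T.
Proof.
apply: opnorm_le => [|x]; first by rewrite mulr_ge0 ?opnorm_ge0.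
by rewrite normrZ -mulrA ler_wpM2l ?le_opnorm.
Qed.

Fact opnorm0_eq0 T : opnorm T = 0 -> T = 0.
Proof.
move=> T0; apply: operator_ext => x; apply/eqP; rewrite -normr_le0.
by rewrite (le_trans (le_opnorm T x))// T0 mul0r.
Qed.

Fact opnormZ a T : opnorm (a *: T) = `|a| * opnorm T.
Proof.
apply/eqP; rewrite eq_le opnormZ_le /=.
have [->|a0] := eqVneq a 0; first by rewrite normr0 mul0r opnorm_ge0.
rewrite -ler_pdivlMl ?normr_gt0// -normfV.
by rewrite (le_trans _ (opnormZ_le _ _))// scalerA mulVf// scale1r.
Qed.

HB.instance Definition _ := Lmodule_isNormed.Build R[i] (operator X Y)
  opnormD opnormZ opnorm0_eq0.

End OperatorNorm.

Section OperatorComplete.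
Context (R : realType) (X : normedModType R[i]) (Y : completeNormedModType R[i]).

Lemma opnormE (T : operator X Y) : `|T| = opnorm T.
Proof. by []. Qed.

Fact operator_complete (F : set_system (operator X Y)) :
  ProperFilter F -> cauchy F -> cvg F.
Proof.
move=> FF Fc.
have FcP e : 0 < e -> exists T, F (ball T e).
  by move=> e0; have /cauchyP/(_ e e0) := Fc.
have evc x : cvg ((fun T : operator X Y => T x) @ F).
  apply: cauchy_cvg; apply/cauchyP => e e0.
  have d0 : 0 < e / (1 + `|x|) by rewrite divr_gt0// ltr_pwDl.
  have [T FT] := FcP _ d0; exists (T x).
  apply: (@filterS _ F _ (ball T (e / (1 + `|x|)))) FT => S.
  rewrite -!ball_normE /ball_/= => TS.
  rewrite (le_lt_trans (le_opnorm (T - S) x))//.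
  rewrite ltr_pdivlMr ?ltr_pwDl// in TS; apply: le_lt_trans TS.
  by rewrite ler_wpM2l ?opnorm_ge0// lerDr.
pose L x := lim ((fun T : operator X Y => T x) @ F).
have LP x : (fun T : operator X Y => T x) @ F --> L x by exact: evc.
have Ll : linear L.
  move=> a x y; apply: (cvg_unique (@norm_hausdorff _ Y) (LP _)).
  rewrite (_ : (fun T : operator X Y => T (a *: x + y)) =
      (fun T : operator X Y => a *: T x + T y)).
    exact: (cvgD (cvgZl_tmp (k := a) (LP x)) (LP y)).
  by apply/funext => T; rewrite linearP.
pose Lm := GRing.isLinear.Build R[i] X Y _ L Ll.
pose L' : {linear X -> Y} := HB.pack L Lm.
have near_le T e x : F (ball T e) -> `|T x - L x| <= e * `|x|.
  move=> FT; apply/ler_addgt0Pr => d d0.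
  have FL : F [set S : operator X Y | `|L x - S x| <= d].
    by have /cvgrPdist_le/(_ d d0) := LP x.
  have [S []] := @filter_ex _ F _ _ (filterI FT FL).
  rewrite -ball_normE /ball_/= => /ltW TS LS.
  have -> : T x - L x = (T - S) x - (L x - S x).
    by rewrite /= opprB addrA subrK.
  rewrite (le_trans (ler_normB _ _))// lerD// (le_trans (le_opnorm _ x))//.
  by rewrite ler_wpM2r.
have Lc : continuous L.
  have [T FT] := FcP 1 ltr01.
  apply: (@bounded_linear_continuous _ _ _ L'); apply/linear_boundedP.
  near=> r => x /=.
  have -> : L x = T x - (T x - L x) by rewrite opprB addrC subrK.
  rewrite (le_trans (ler_normB _ _))//.
  rewrite (le_trans (lerD (le_opnorm T x) (near_le _ _ _ FT)))//.
  rewrite -mulrDl ler_wpM2r//; near: r; apply: nbhs_pinfty_ge.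
  by rewrite ger0_real// addr_ge0// opnorm_ge0.
have LPP : L \in @operator_pred _ X Y by apply/asboolP.
apply/cvg_ex; exists (Operator LPP); apply/cvgrPdist_le => e e0.
have e20 : 0 < e / 2 by rewrite divr_gt0.
have [T FT] := FcP _ e20.
have TL := near_le _ _ _ FT; apply: (@filterS _ F _ (ball T (e / 2))) FT => S TS.
rewrite opnormE; apply: opnorm_le => [|x]; first exact: ltW.
have -> : (Operator LPP - S) x = (T x - S x) - (T x - L x).
  by rewrite opprB [RHS]addrC addrA subrK.
rewrite (le_trans (ler_normB _ _))// [in leRHS](splitr e) mulrDl.
rewrite lerD ?TL//; move: TS; rewrite -ball_normE /ball_/= => /ltW TS.
by rewrite (le_trans (le_opnorm (T - S) x))// ler_wpM2r.
Unshelve. all: by end_near. Qed.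

HB.instance Definition _ := Uniform_isComplete.Build (operator X Y) operator_complete.

End OperatorComplete.

Section ComplexComplete.
Context (R : realType).

Let normc_ge_Im (z : R[i]) : `|complex.Im z|%:C <= `|z|.
Proof.
have -> : `|z| = `|z * 'i%C|.
  rewrite normrM (_ : `|'i%C| = 1) ?mulr1// normc_def /=.
  by rewrite expr0n expr1n add0r sqrtr1.
by rewrite -normrN -ReiNIm normc_ge_Re.
Qed.

Lemma complex_complete (F : set_system R[i]^o) :
  ProperFilter F -> cauchy F -> cvg F.
Proof.
move=> FF /cauchyP Fc.
have cvg_part (f : R[i] -> R) : (forall z w, f (z - w) = f z - f w) ->
    (forall z, `|f z|%:C <= `|z|) -> cvg (f @ F).
  move=> fB f_le; apply: cauchy_cvg; apply/cauchyP => e e0.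
  have [|z Fz] := Fc e%:C; first by rewrite ltcR.
  exists (f z); apply: (@filterS _ F _ (ball z e%:C)) Fz => w.
  rewrite -!ball_normE /ball_/= => zw; rewrite -fB -ltcR.
  exact: le_lt_trans (f_le _) zw.
have /cvg_ex[a Fa] := cvg_part (@complex.Re R)
  (fun z w => match z, w with _ +i* _, _ +i* _ => erefl end) (@normc_ge_Re R).
have /cvg_ex[b Fb] := cvg_part (@complex.Im R)
  (fun z w => match z, w with _ +i* _, _ +i* _ => erefl end) normc_ge_Im.
apply/cvg_ex; exists (a +i* b); apply/cvgrPdist_le => e e0.
have eE := RRe_real (gtr0_real e0).
have re0 : 0 < complex.Re e / 2 by rewrite divr_gt0// -ltcR eE.
move/cvgrPdist_le/(_ _ re0) : Fa; move/cvgrPdist_le/(_ _ re0) : Fb => Fb Fa.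
apply: (@filterS2 _ F _ _ _ _ _ Fa Fb) => -[x y] /= ax bY.
rewrite [_ - _]complexE /= (le_trans (ler_normD _ _))// normrM.
have -> : `|'i%C : R[i]| = 1.
  by rewrite normc_def /= expr0n expr1n add0r sqrtr1.
have normC (t : R) : `|t%:C| = `|t|%:C.
  by rewrite normc_def /= expr0n addr0 sqrtr_sqr.
by rewrite mul1r !normC -raddfD/= -eE lecR [leRHS]splitr lerD.
Qed.

Lemma closed_add_line (V : normedModType R[i]) (J : set V) (v : V) :
  is_subspace J -> closed J ->
  closed [set x | exists s a, J s /\ x = s + a *: v].
Proof.
move=> [J0 JP] Jc.
have JZ a s : J s -> J (a *: s).
  by move=> Js; rewrite -[_ *: _]addr0; apply: JP.
have JB s t : J s -> J t -> J (s - t).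
  by move=> Js Jt; rewrite addrC -scaleN1r; apply: JP.
have [Jv|nJv] := pselect (J v).
  rewrite (_ : [set _ | _] = J)//; apply/seteqP; split => [x [s [a [Js ->]]]|x Jx].
    by rewrite addrC; apply: JP.
  by exists x, 0; rewrite scale0r addr0.
have [d d0 dJ] : exists2 d : R[i], 0 < d & forall s, J s -> d <= `|v - s|.
  have : nbhs v (~` J) by apply: open_nbhs_nbhs; split=> //; exact: closed_openC.
  move=> /nbhs_ballP[d /= d0 dJ]; exists d => // s Js.
  rewrite (real_leNgt (gtr0_real d0) (normr_real _)); apply/negP => vs.
  by apply: (dJ s _ Js); rewrite -ball_normE.
have J_le : forall s a, J s -> d * `|a| <= `|s + a *: v|.
  move=> s a Js; have [->|a0] := eqVneq a 0; first by rewrite normr0 mulr0.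
  have -> : s + a *: v = a *: (v - (- a^-1 *: s)).
    by rewrite scaleNr opprK scalerDr scalerA mulfV// scale1r addrC.
  by rewrite normrZ mulrC ler_wpM2l// dJ//; exact: JZ.
set A := [set x | _].
have /choice[c cP] : forall x, exists a, A x -> J (x - a *: v).
  move=> x; have [[s [a [Js ->]]]|nA] := pselect (A x); last by exists 0.
  by exists a; rewrite addrK.
have c_le x y : A x -> A y -> d * `|c x - c y| <= `|x - y|.
  move=> Ax Ay.
  have -> : x - y = (x - c x *: v) - (y - c y *: v) + (c x - c y) *: v.
    rewrite scalerBl opprB [RHS]addrC addrACA addKr.
    by rewrite [c x *: v + _]addrC subrK.
  exact: J_le (JB _ _ (cP x Ax) (cP y Ay)).
move=> x xA.
pose F := within A (nbhs x).
have FF : ProperFilter F by apply: within_nbhs_proper.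
have FA : F A by apply: withinT.
have Fx : id @ F --> x by apply: cvg_within.
have /cvg_ex[a ca] : cvg (c @ F : set_system R[i]^o).
  apply: complex_complete; apply/cauchyP => e e0.
  have ed0 : 0 < d * e / 2 by rewrite divr_gt0// mulr_gt0.
  move/cvgrPdist_lt/(_ _ ed0) : (Fx) => Fe.
  have [y [/= Ay xy]] := @filter_ex _ F _ _ (filterI FA Fe).
  exists (c y); apply: (@filterS2 _ F _ _ _ _ _ FA Fe) => z /= Az xz.
  rewrite -ball_normE /ball_/= -(ltr_pM2l d0).
  rewrite (le_lt_trans (c_le _ _ Ay Az))// [ltRHS]splitr.
  by rewrite (le_lt_trans (ler_distD x _ _))// ltrD// distrC.
exists (x - a *: v), a; rewrite subrK; split=> //.
have : (fun y => y - c y *: v) @ F --> x - a *: v.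
  by apply: cvgB => //; apply: cvgZr_tmp.
move: (x - a *: v); apply: closed_cvg => //.
by apply: filterS FA => y; exact: cP.
Qed.

End ComplexComplete.

(* The norm is a field rather than the library norm: Hierarchy-Builder rejects a
   structure joining noncommutative rings with normed Z-modules.  It induces the
   uniform structure; the unit is that of [algType], where 1 != 0. *)
HB.mixin Record isBanachAlgebra (K : numFieldType) A
    of Uniform A & GRing.Algebra K A := {
  banach_norm : A -> K;
  banach_normD : forall x y, banach_norm (x + y) <= banach_norm x + banach_norm y;
  banach_normZ : forall (a : K) x, banach_norm (a *: x) = `|a| * banach_norm x;
  banach_norm_eq0 : forall x, banach_norm x = 0 -> x = 0;
  banach_normM : forall x y, banach_norm (x * y) <= banach_norm x * banach_norm y;
  banach_entourageE : entourage = entourage_ (ball_ banach_norm);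
  banach_complete : forall F : set_system A, ProperFilter F -> cauchy F -> exists x : A, F --> x }.

#[short(type="banachAlgType")]
HB.structure Definition BanachAlgebra (K : numFieldType) :=
  {A of Uniform A & GRing.Algebra K A & isBanachAlgebra K A}.
Section Composition.
Context (K : numFieldType) (X Y Z : normedModType K).

Fact comp_op_subproof (T : operator Y Z) (S : operator X Y) :
  T \o S \in @operator_pred K X Z.
Proof.
apply/asboolP; split; first by move=> a x y; rewrite /= !linearP.
move=> x; apply: continuous_comp; exact: operator_continuous.
Qed.

Definition comp_op (T : operator Y Z) (S : operator X Y) : operator X Z :=
  Operator (comp_op_subproof T S).

End Composition.

Section Identity.
Context (K : numFieldType) (X : normedModType K).

Fact id_op_subproof : idfun \in @operator_pred K X X.
Proof. by apply/asboolP; split=> // x; exact: cvg_id. Qed.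

Definition id_op : operator X X := Operator id_op_subproof.

End Identity.

(* Banach spaces are complex and infinite-dimensional throughout. *)
Record banachSpace (R : realType) := BanachSpace {
  banach_sort :> completeNormedModType R[i];
  banach_infinite_dim : ~ finite_dimensional [set: banach_sort] }.

(* B(X) = B(X, X), with composition as product and the operator norm. *)
Definition endo (R : realType) (X : banachSpace R) : Type := operator X X.

Section EndoAlgebra.
Context (R : realType) (X : banachSpace R).

HB.instance Definition _ := CompleteNormedModule.on (endo X).

Let mul (S T : endo X) : endo X := comp_op S T.
Let one : endo X := id_op X.

Let mulA : associative mul. Proof. by move=> S T U; exact: operator_ext. Qed.
Let mul1 : left_id one mul. Proof. by move=> S; exact: operator_ext. Qed.
Let mulr1 : right_id one mul. Proof. by move=> S; exact: operator_ext. Qed.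
Let mulDl : left_distributive mul +%R.
Proof. by move=> S T U; exact: operator_ext. Qed.
Let mulDr : right_distributive mul +%R.
Proof. by move=> S T U; apply: operator_ext => x; rewrite /= linearD. Qed.

Let one_neq0 : one != 0.
Proof.
apply/eqP => eq10; apply: (@banach_infinite_dim R X).
exists 0, (fun=> 0); apply/seteqP; split=> // x _.
exists (fun=> 0) => //; rewrite big_ord0.
by have /(congr1 (fun T : endo X => T x)) := eq10.
Qed.

HB.instance Definition _ :=
  GRing.Zmodule_isNzRing.Build (endo X) mulA mul1 mulr1 mulDl mulDr one_neq0.

Let scaleAl (a : R[i]) (S T : endo X) : a *: (S * T) = (a *: S) * T.
Proof. exact: operator_ext. Qed.
Let scaleAr (a : R[i]) (S T : endo X) : a *: (S * T) = S * (a *: T).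
Proof. by apply: operator_ext => x; rewrite /= linearZ. Qed.

HB.instance Definition _ := GRing.Lmodule_isLalgebra.Build R[i] (endo X) scaleAl.
HB.instance Definition _ := GRing.Lalgebra_isAlgebra.Build R[i] (endo X) scaleAr.

Let normM (S T : endo X) : `|S * T| <= `|S| * `|T|.
Proof.
apply: opnorm_le => [|x]; first by rewrite mulr_ge0.
rewrite (le_trans (le_opnorm S (T x)))// -mulrA.
by apply: ler_wpM2l (le_opnorm T x); exact: opnorm_ge0.
Qed.

Let entourageE : @entourage (endo X) = entourage_ (ball_ (@Num.norm _ (endo X))).
Proof. by rewrite -entourage_ballE -ball_normE. Qed.

HB.instance Definition _ := isBanachAlgebra.Build R[i] (endo X)
  (@ler_normD _ (endo X)) (@normrZ _ (endo X)) (@normr0_eq0 _ (endo X))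
  normM entourageE (fun F FF Fc => (cvg_ex F).1 (@cauchy_cvg (endo X) F FF Fc)).

Lemma endo_oneE : (1 : endo X) = id_op X. Proof. by []. Qed.
Lemma endo_mulE (S T : endo X) : S * T = comp_op S T. Proof. by []. Qed.

End EndoAlgebra.

Section OperatorIdeals.
Context (R : realType).

Record operatorIdeal := OperatorIdeal {
  ideal_set :> forall X Y : banachSpace R, set (operator X Y);
  ideal_subspace : forall X Y, is_subspace (@ideal_set X Y);
  ideal_comp : forall (W X Y Z : banachSpace R)
      (Q : operator W X) (S : operator X Y) (T : operator Y Z),
    ideal_set S -> ideal_set (comp_op T (comp_op S Q)) }.

Arguments ideal_set I X Y : clear implicits, rename.

Definition nonzero_ideal (I : operatorIdeal) : Prop :=
  forall X Y : banachSpace R, I X Y <> [set 0].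

Record closedIdeal := ClosedIdeal {
  closed_ideal_base :> operatorIdeal;
  closed_idealP : forall X Y, closed (closed_ideal_base X Y) }.

Definition bounded_below_on (X Y : banachSpace R) (S : operator X Y)
    (E : set X) : Prop :=
  exists2 c : R[i], 0 < c & forall x, E x -> c * `|x| <= `|S x|.

Definition strictly_singular (X Y : banachSpace R) : set (operator X Y) :=
  [set S | forall E : set X,
     is_subspace E -> bounded_below_on S E -> finite_dimensional E].

End OperatorIdeals.
Arguments strictly_singular {R} X Y.

(* I(X)^# realised as I(X) + C1 inside B(X).  When I is contained in the strictly
   singular operators, 1 is not in I(X) and the sum is direct. *)
Section Unitization.
Context (R : realType) (I : closedIdeal R) (X : banachSpace R).

Definition unitization_pred : {pred endo X} :=
  [pred T | `[< exists (S : endo X) (a : R[i]), I X X S /\ T = S + a%:A >]].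

Record unitization := Unitization {
  unitization_val :> endo X;
  unitizationP : unitization_val \in unitization_pred }.

HB.instance Definition _ := [isSub for unitization_val].
HB.instance Definition _ := [Choice of unitization by <:].

Let idealM (S T : endo X) : I X X S -> I X X (S * T).
Proof.
move=> /(ideal_comp T (id_op X)).
by rewrite (_ : comp_op _ _ = S * T)//; exact: operator_ext.
Qed.

Fact unitization_subalg_closed : subalg_closed unitization_pred.
Proof.
have [I0 IP] := @ideal_subspace R I X X.
have ID (S T : endo X) : I X X S -> I X X T -> I X X (S + T).
  by move=> IS IT; have := IP 1 S T IS IT; rewrite scale1r.
have IZ a (S : endo X) : I X X S -> I X X (a *: S).
  by move=> IS; have := IP a S 0 IS I0; rewrite addr0.
split.
- by apply/asboolP; exists 0, 1; rewrite scale1r add0r.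
- move=> c _ _ /asboolP[S [a [IS ->]]] /asboolP[T [b [IT ->]]].
  apply/asboolP; exists (c *: S + T), (c * a + b); split; first exact: IP.
  by rewrite scalerDr scalerA scalerDl addrACA.
move=> _ _ /asboolP[S [a [IS ->]]] /asboolP[T [b [IT ->]]].
apply/asboolP; exists (S * (T + b%:A) + a *: T), (a * b); split.
  by apply: ID; [exact: idealM|exact: IZ].
by rewrite mulrDl -[a%:A * _]scalerAl mul1r scalerDr scalerA addrA.
Qed.

HB.instance Definition _ := GRing.isSubalgClosed.Build R[i] (endo X)
  unitization_pred unitization_subalg_closed.
HB.instance Definition _ := [SubChoice_isSubAlgebra of unitization by <:].

Let norm (T : unitization) : R[i] := `|val T|.

Let normD (S T : unitization) : norm (S + T) <= norm S + norm T.
Proof. exact: ler_normD. Qed.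
Let normZ (a : R[i]) (T : unitization) : norm (a *: T) = `|a| * norm T.
Proof. exact: normrZ. Qed.
Let norm0 (T : unitization) : norm T = 0 -> T = 0.
Proof. by move=> /normr0_eq0 T0; exact: val_inj. Qed.

HB.instance Definition _ :=
  Lmodule_isNormed.Build R[i] unitization normD normZ norm0.

Fact unitization_complete (F : set_system unitization) :
  ProperFilter F -> cauchy F -> cvg F.
Proof.
move=> FF /cauchyP Fc.
have /cvg_ex[T vT] : cvg (val @ F : set_system (endo X)).
  apply: cauchy_cvg; apply/cauchyP => e e0; have [S FS] := Fc e e0.
  exists (val S); apply: (@filterS _ F _ (ball S e)) FS => U.
  by rewrite -!ball_normE.
have TP : T \in unitization_pred.
  apply/asboolP; have := closed_add_line (v := 1 : endo X)
    (@ideal_subspace R I X X) (@closed_idealP R I X X).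
  move=> Ac; apply: (closed_cvg _ Ac _ T vT).
  by apply: nearW => S; apply/asboolP; exact: unitizationP.
apply/cvg_ex; exists (Unitization TP); apply/cvgrPdist_le => e e0.
by move/cvgrPdist_le/(_ e e0) : vT.
Qed.

HB.instance Definition _ :=
  Uniform_isComplete.Build unitization unitization_complete.

Let normM (S T : unitization) : `|S * T| <= `|S| * `|T|.
Proof. exact: (@banach_normM R[i] (endo X)). Qed.

Let entourageE :
  @entourage unitization = entourage_ (ball_ (@Num.norm _ unitization)).
Proof. by rewrite -entourage_ballE -ball_normE. Qed.

HB.instance Definition _ := isBanachAlgebra.Build R[i] unitization
  (@ler_normD _ unitization) (@normrZ _ unitization) (@normr0_eq0 _ unitization)
  normM entourageE (fun F FF Fc => (cvg_ex F).1 (@cauchy_cvg unitization F FF Fc)).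

End Unitization.

Section K1.
Context (R : realType) (A : banachAlgType R[i]).

Definition Inv (n : nat) : set 'M[A]_n :=
  [set U | exists V : 'M[A]_n, U *m V = 1%:M /\ V *m U = 1%:M].

Record InvInf := InInv {
  inv_size : nat;
  inv_size_gt0 : (0 < inv_size)%N;
  inv_mx : 'M[A]_inv_size;
  inv_mxP : Inv inv_mx }.

(* diag(U, I^(k-m)); the cast is along m + (k - m) = k. *)
Definition stabilize (m k : nat) (mk : (m <= k)%N) (U : 'M[A]_m) : 'M[A]_k :=
  castmx (subnKC mk, subnKC mk) (block_mx U 0 0 (1%:M : 'M[A]_(k - m))).

(* The library topology on matrices is the entrywise one, i.e. the topology of
   the Banach algebra M_k(A). *)
Definition path_in (k : nat) (S : set 'M[A]_k) (U V : 'M[A]_k) : Prop :=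
  exists g : R -> 'M[A]_k,
    [/\ {within `[0%R, 1%R], continuous g},
        forall t, t \in `[0%R, 1%R] -> S (g t), g 0 = U & g 1 = V].

Definition K1_equiv (U V : InvInf) : Prop :=
  exists (k : nat) (mk : (inv_size U < k)%N) (nk : (inv_size V < k)%N),
    path_in (@Inv k) (stabilize (ltnW mk) (inv_mx U))
                     (stabilize (ltnW nk) (inv_mx V)).

Definition K1_class (U : InvInf) : set InvInf := [set V | K1_equiv U V].

Definition K1 : set (set InvInf) := range K1_class.

Fact Inv1 : Inv (1%:M : 'M[A]_1).
Proof. by exists 1%:M; rewrite mulmx1. Qed.

(* The class of the identity matrix is the neutral element of K_1(A) for
   [U] + [V] = [diag(U, V)], because diag(U, I) ~_1 U. *)
Definition K1_zero : set InvInf := K1_class (InInv (ltn0Sn 0) Inv1).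

End K1.
Arguments K1 {R} A.
Arguments K1_zero {R} A.

(* The K_1-group of the non-unital Banach algebra I(X) is that of its
   unitization I(X) + C1. *)
Definition K1_ideal (R : realType) (I : closedIdeal R) (X : banachSpace R) :
    set (set (InvInf (unitization I X))) :=
  K1 (unitization I X).

Definition K1_ideal_zero (R : realType) (I : closedIdeal R)
    (X : banachSpace R) : set (InvInf (unitization I X)) :=
  K1_zero (unitization I X).
Arguments K1_ideal {R} I X.
Arguments K1_ideal_zero {R} I X.

(* Main.v *)
(* A strictly singular T is a Riesz operator: if S = 1 + q T with q != 0, then S is
   bounded below on the kernel of some finite-rank idempotent P, since otherwise
   biorthogonal unit vectors (Hahn-Banach) on which S is tiny would span a space on
   which T is bounded below.  If moreover q is a limit of points z with 1 + z T
   invertible, S differs from an invertible operator by a finite-rank one, so near q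
   the invertibility of 1 + z T is governed by the zeros of an analytic determinant.
   Hence 1 + z T is invertible along some curve from 0 to 1 (end point excepted).
   It follows that in C1 + I(X) the invertible elements are dense and connected, and
   Gaussian elimination carries connectedness over to all matrix groups; thus the
   n = 1 case of the spectral argument suffices, and X^n never appears. *)

From HB Require Import structures.
Require Import Defs.
From mathcomp Require Import all_boot all_order all_algebra.
From mathcomp Require Import all_classical all_reals all_analysis.
From mathcomp Require Import complex.
From mathcomp Require Import ring lra.

Set Implicit Arguments.
Unset Strict Implicit.
Unset Printing Implicit Defensive.

Import Order.TTheory GRing.Theory Num.Theory.
Import numFieldTopology.Exports numFieldNormedType.Exports.

Local Open Scope classical_set_scope.
Local Open Scope complex_scope.
Local Open Scope ring_scope.

(** The delicate passage is from 1 + z T, invertible for z near q, to S = 1 + q T: the inverses may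
    blow up as z tends to q, so S need not be a small perturbation relative to any of them. On ker
    P, however, 1 + z T inherits a lower bound from S. An invertible operator can be redefined on
    the range of P so as to become bounded below everywhere, by a constant that depends only on P
    and on the bound on ker P ([finproj_correction]). A Neumann series then works with a closeness
    fixed in advance. This takes the place of the Fredholm index: being a limit of good points plays
    the role of index 0, and it also keeps the determinant from vanishing identically. A bad point
    may lie on the segment [0, 1] itself, hence the arcs above it; a supremum argument carries the
    limit property along the segment. In C1 + I(X) the arc serves twice: stopped just before its end
    it gives density, and run to its end, when that end is invertible, it gives connectedness. *)

Lemma expr_small (R : realType) (q e : R[i]) :
  0 <= q -> q < 1 -> 0 < e -> exists n, forall m, (n <= m)%N -> q ^+ m < e.
Proof.
move=> q0 q1 e0; have qr := RRe_real (ger0_real q0); have er := RRe_real (gtr0_real e0).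
move: q0 q1 e0; rewrite -qr -er; move: (complex.Re q) (complex.Re e) => {q qr}x {e er}y.
rewrite lecR -[1]/(1%:C) !ltcR => x0 x1 y0.
have : `|x| < 1 by rewrite ger0_norm.
move=> /cvg_expr /cvgrPdist_lt /(_ y y0)[n _ nP]; exists n => m /nP /=.
by rewrite sub0r normrN ger0_norm ?exprn_ge0// -rmorphXn /= ltcR.
Qed.

Lemma normc_real (R : realType) (t : R) : `|t%:C| = `|t|%:C.
Proof. by rewrite normc_def /= expr0n addr0 sqrtr_sqr. Qed.

Lemma normc_le_D (R : realType) (a b : R) : `|a +i* b| <= (`|a| + `|b|)%:C.
Proof.
rewrite [a +i* b]complexE/= (le_trans (ler_normD _ _))// normrM.
have -> : `|'i%C : R[i]| = 1 by rewrite normc_def /= expr0n expr1n add0r sqrtr1.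
by rewrite mul1r !normc_real rmorphD.
Qed.

Lemma pos_lower_bound (K : numFieldType) (a b : K) : 0 < a -> 0 < b ->
  exists e, [/\ 0 < e, e <= a & e <= b].
Proof.
move=> a0 b0; have ab0 : 0 < a + b by rewrite addr_gt0.
(* This value lies below both a and b, so the two need not be compared in a partially ordered
   field. *)
exists (a * b / (a + b)); split; first by rewrite divr_gt0// mulr_gt0.
  by rewrite ler_pdivrMr// ler_pM2l// lerDr ltW.
by rewrite ler_pdivrMr// mulrC ler_pM2l// lerDl ltW.
Qed.

(** * Invertible elements and the Neumann series *)

Definition invertible (A : nzRingType) (a : A) := exists b, a * b = 1 /\ b * a = 1.

Lemma invertible1 (A : nzRingType) : invertible (1 : A).
Proof. by exists 1; rewrite mulr1. Qed.

Lemma invertibleM (A : nzRingType) (a b : A) :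
  invertible a -> invertible b -> invertible (a * b).
Proof.
move=> [a' [aa' a'a]] [b' [bb' b'b]]; exists (b' * a'); split.
  by rewrite mulrA -(mulrA a) bb' mulr1.
by rewrite mulrA -(mulrA b') a'a mulr1.
Qed.

Section BanachAlgebra.
Context (R : realType) (A : banachAlgType R[i]).
Implicit Types (a b d x : A) (e : R[i]).
Local Notation N := (@banach_norm R[i] A).

Lemma banach_norm0 : N 0 = 0.
Proof. by rewrite -(scale0r (0 : A)) banach_normZ normr0 mul0r. Qed.

Lemma banach_normN a : N (- a) = N a.
Proof. by rewrite -scaleN1r banach_normZ normrN normr1 mul1r. Qed.

Lemma banach_norm_ge0 a : 0 <= N a.
Proof.
have := banach_normD a (- a); rewrite subrr banach_norm0 banach_normN.
by rewrite -mulr2n pmulrn_lge0.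
Qed.
#[local] Hint Resolve banach_norm_ge0 : core.

(** The norm of 1 is not assumed to be 1, hence the factor [N 1], which also makes the case n = 0
    true. *)
Lemma banach_normX a n : N (a ^+ n) <= N 1 * N a ^+ n.
Proof.
elim: n => [|n IHn]; first by rewrite !expr0 mulr1.
by rewrite !exprSr (le_trans (banach_normM _ _))// mulrA ler_wpM2r.
Qed.

Lemma banach_nbhsP x (P : set A) :
  nbhs x P <-> exists2 e, 0 < e & forall y, N (x - y) < e -> P y.
Proof.
rewrite -nbhs_entourageE /nbhs_ banach_entourageE; split.
  move=> [B [e /= e0 eB] BP]; exists e => // y xy; apply: BP.
  by rewrite /xsection/= inE; apply: (eB (x, y)).
move=> [e e0 eP]; exists [set xy | N (xy.1 - xy.2) < e]; first by exists e.
by move=> y; rewrite /xsection/= inE => /eP.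
Qed.

Lemma banach_cauchy (u : nat -> A) :
  (forall e, 0 < e -> exists n, forall m, (n <= m)%N -> N (u m - u n) < e) ->
  exists x, forall e, 0 < e -> exists n, forall m, (n <= m)%N -> N (x - u m) < e.
Proof.
move=> uC; have [|x ux] := @banach_complete R[i] A (u @ \oo) _.
  move=> B; rewrite banach_entourageE => -[e /= e0 eB].
  have e2 : 0 < e / 2 by rewrite divr_gt0.
  have [n nP] := uC _ e2.
  exists ([set y | N (y - u n) < e / 2], [set y | N (y - u n) < e / 2]).
    by split; exists n => // m /nP.
  move=> [y z] [/= yn zn]; apply: (eB (y, z)) => /=; rewrite /ball_/=.
  have -> : y - z = (y - u n) + (- (z - u n)) by rewrite opprB addrA subrK.
  rewrite (le_lt_trans (banach_normD _ _))// banach_normN.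
  by rewrite [e]splitr ltrD.
exists x => e e0; have /ux[n _ nP] : nbhs x [set y | N (x - y) < e].
  by apply/banach_nbhsP; exists e.
by exists n.
Qed.

Lemma neumann d : N d < 1 -> invertible (1 - d).
Proof.
move=> d1; pose s n := \sum_(i < n) d ^+ i.
have sE n : s n * (1 - d) = 1 - d ^+ n /\ (1 - d) * s n = 1 - d ^+ n.
  elim: n => [|n [IH1 IH2]]; first by rewrite /s big_ord0 mul0r mulr0 subrr.
  rewrite /s big_ord_recr/= -/(s n); split.
    by rewrite mulrDl IH1 mulrBr mulr1 -exprSr addrA subrK.
  by rewrite mulrDr IH2 mulrBl mul1r -exprS addrA subrK.
have dpos : 0 < 1 - N d by rewrite subr_gt0.
have sB n m : (n <= m)%N -> N (s m - s n) <= N 1 * N d ^+ n / (1 - N d).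
  move=> nm; rewrite ler_pdivlMr// -(subnKC nm); move: (m - n)%N => k {m nm}.
  (* The sharper bound, with the tail subtracted, is the one that telescopes under induction on
     k. *)
  suff : N (s (n + k)%N - s n) * (1 - N d) <= N 1 * (N d ^+ n - N d ^+ (n + k)).
    by move=> /le_trans; apply; rewrite ler_wpM2l// lerBlDr lerDl exprn_ge0.
  elim: k => [|k IHk]; first by rewrite addn0 subrr banach_norm0 mul0r subrr mulr0.
  rewrite addnS /s big_ord_recr/= -/(s _) -/(s n) addrAC.
  have -> : N d ^+ n - N d ^+ (n + k).+1 =
    N d ^+ n - N d ^+ (n + k) + N d ^+ (n + k) * (1 - N d).
    by rewrite mulrBr mulr1 -exprSr addrA subrK.
  rewrite [leRHS]mulrDr [N 1 * (_ * (1 - _))]mulrA.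
  apply: le_trans (lerD IHk (ler_wpM2r (ltW dpos) (banach_normX d (n + k)))).
  by rewrite -mulrDl ler_wpM2r ?(ltW dpos)// banach_normD.
have [|x xP] := @banach_cauchy s.
  move=> e e0; have c0 : 0 < e * (1 - N d) / (1 + N 1).
    by rewrite divr_gt0// ?mulr_gt0// ltr_pwDl.
  have [n nP] := expr_small (banach_norm_ge0 d) d1 c0; exists n => m /sB/le_lt_trans; apply.
  have := nP n (leqnn n); rewrite ltr_pdivlMr ?ltr_pwDl// ltr_pdivrMr// mulrC.
  by apply: le_lt_trans; rewrite mulrDl ler_wpDl// mul1r exprn_ge0.
(* The two summands will bound the remainder [d ^+ n] and the product of [1 - d] with the error
   [x - s n]. *)
have tiny (y : A) : (forall e, 0 < e -> N y <= e * (N 1 + N (1 - d))) -> y = 0.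
  move=> yP; apply: banach_norm_eq0; apply/eqP; rewrite eq_le banach_norm_ge0 andbT.
  apply/ler_addgt0Pr => e e0; rewrite add0r.
  have c0 : 0 < 1 + (N 1 + N (1 - d)) by rewrite ltr_pwDl// addr_ge0.
  apply: le_trans (yP (e / (1 + (N 1 + N (1 - d)))) (divr_gt0 e0 c0)) _.
  by rewrite mulrAC ler_pdivrMr// ler_wpM2l ?(ltW e0)// lerDr.
exists x; split; apply/eqP; rewrite -subr_eq0; apply/eqP; apply: tiny => e e0;
  have [n1 n1P] := xP e e0;
  have [n2 n2P] := expr_small (banach_norm_ge0 d) d1 e0;
  pose n := maxn n1 n2; have [sl sr] := sE n.
- have -> : (1 - d) * x - 1 = (1 - d) * (x - s n) - d ^+ n.
    by rewrite mulrBr sr opprB addrA addrAC addrK.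
  rewrite (le_trans (banach_normD _ _))// banach_normN [leRHS]mulrDr [leRHS]addrC lerD//; last first.
    rewrite (le_trans (banach_normX _ _))// mulrC ler_wpM2r//.
    by rewrite ltW// n2P// leq_maxr.
  by rewrite (le_trans (banach_normM _ _))// mulrC ler_wpM2r// ltW// n1P// leq_maxl.
- have -> : x * (1 - d) - 1 = (x - s n) * (1 - d) - d ^+ n.
    by rewrite mulrBl sl opprB addrA addrAC addrK.
  rewrite (le_trans (banach_normD _ _))// banach_normN [leRHS]mulrDr [leRHS]addrC lerD//; last first.
    rewrite (le_trans (banach_normX _ _))// mulrC ler_wpM2r//.
    by rewrite ltW// n2P// leq_maxr.
  by rewrite (le_trans (banach_normM _ _))// ler_wpM2r// ltW// n1P// leq_maxl.
Qed.

End BanachAlgebra.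

(** * Matrices over a Banach algebra *)

Section Paths.
Context (R : realType) (A : banachAlgType R[i]).
Implicit Types (a b : A) (p q : R -> A).
Local Notation N := (@banach_norm R[i] A).
Let norm_ge0 (a : A) : 0 <= N a := banach_norm_ge0 a.
#[local] Hint Resolve norm_ge0 : core.

Lemma banach_continuousP p : continuous p <->
  forall t (e : R[i]), 0 < e -> \forall s \near t, N (p t - p s) < e.
Proof.
split => [pc t e e0|pc t B].
  by apply: (pc t [set x | N (p t - x) < e]); apply/banach_nbhsP; exists e.
by move=> /banach_nbhsP[e e0 eB]; apply: filterS (pc t e e0) => s /eB.
Qed.

Lemma banach_continuousD p q :
  continuous p -> continuous q -> continuous (fun t => p t + q t).
Proof.
move=> /banach_continuousP pc /banach_continuousP qc; apply/banach_continuousP.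
move=> t e e0; have e2 : 0 < e / 2 by rewrite divr_gt0.
apply: filterS2 (pc t _ e2) (qc t _ e2) => s ps qs.
by rewrite opprD addrACA (le_lt_trans (banach_normD _ _))// [e]splitr ltrD.
Qed.

Lemma banach_continuousM p q :
  continuous p -> continuous q -> continuous (fun t => p t * q t).
Proof.
move=> /banach_continuousP pc /banach_continuousP qc; apply/banach_continuousP.
move=> t e e0; pose c := 1 + N (p t) + N (q t).
have c0 : 0 < c by rewrite /c -addrA ltr_pwDl ?addr_ge0.
(* Gives d <= 1 and c * d < e at once; the former bounds [N (p s)] by [N (p t) + 1]. *)
pose d := e / (c + e).
have ce0 : 0 < c + e by rewrite addr_gt0.
have d0 : 0 < d by rewrite divr_gt0.
have d1 : d <= 1 by rewrite ler_pdivrMr// mul1r lerDr ltW.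
apply: filterS2 (pc t _ d0) (qc t _ d0) => s ps qs.
have -> : p t * q t - p s * q s =
    (p t - p s) * q t + (p t - (p t - p s)) * (q t - q s).
  by rewrite subKr mulrBl mulrBr addrA subrK.
rewrite (le_lt_trans (banach_normD _ _))//.
have h1 : N ((p t - p s) * q t) <= d * N (q t).
  by rewrite (le_trans (banach_normM _ _))// ler_wpM2r// ltW.
have h2 : N ((p t - (p t - p s)) * (q t - q s)) <= (N (p t) + 1) * d.
  rewrite (le_trans (banach_normM _ _))// ler_pM// ?ltW//.
  rewrite (le_lt_trans (banach_normD _ _))// banach_normN ltrD2l.
  exact: lt_le_trans d1.
rewrite (le_lt_trans (lerD h1 h2))// [d * _]mulrC -mulrDl addrC [_ + 1]addrC -/c.
by rewrite /d mulrA ltr_pdivrMr// mulrC ltr_pM2l// ltrDl.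
Qed.

Lemma banach_continuousZ (c : R -> R[i]) a :
  (forall t e, 0 < e -> \forall s \near t, `|c t - c s| < e) ->
  continuous (fun t => c t *: a).
Proof.
move=> cc; apply/banach_continuousP => t e e0.
have d0 : 0 < e / (1 + N a) by rewrite divr_gt0// ltr_pwDl.
apply: filterS (cc t _ d0) => s; rewrite ltr_pdivlMr ?ltr_pwDl// -scalerBl.
by rewrite banach_normZ; apply: le_lt_trans; rewrite ler_wpM2l// lerDr.
Qed.

Lemma continuous_complex (f g : R -> R) : continuous f -> continuous g ->
  forall t (e : R[i]), 0 < e -> \forall s \near t,
    `|(f t +i* g t) - (f s +i* g s)| < e.
Proof.
move=> fc gc t e e0; have er := RRe_real (gtr0_real e0).
have e2 : 0 < complex.Re e / 2 by rewrite divr_gt0// -ltcR er.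
have /cvgrPdist_lt/(_ _ e2) fe := fc t.
have /cvgrPdist_lt/(_ _ e2) ge := gc t.
apply: filterS2 fe ge => s fs gs.
rewrite -er; apply: le_lt_trans (normc_le_D (f t - f s) (g t - g s)) _.
by rewrite ltcR [ltRHS]splitr ltrD.
Qed.

Lemma mx_continuousP m n (g : R -> 'M[A]_(m, n)) :
  (forall i j, continuous (fun t => g t i j)) -> continuous g.
Proof.
move=> gc t B [P Pn PB]; suff : \forall s \near t, forall i j, P i j (g s i j).
  by apply: filterS => s sP; exact: PB.
have tF : Filter (nbhs (t : R)) by exact: nbhs_filter.
apply: (@filter_forall R _ (fun i s => forall j, P i j (g s i j)) (nbhs t) tF) => i.
apply: (@filter_forall R _ (fun j s => P i j (g s i j)) (nbhs t) tF) => j.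
exact: (gc i j t _ (Pn i j)).
Qed.

Lemma continuous_sum (I : Type) (r : seq I) (F : I -> R -> A) :
  (forall i, continuous (F i)) -> continuous (fun t => \sum_(i <- r) F i t).
Proof.
move=> Fc; elim: r => [|i r IHr].
  rewrite (_ : (fun _ => _) = (fun=> 0)); first by move=> t; exact: cvg_cst.
  by apply/funext => t; rewrite big_nil.
rewrite (_ : (fun _ => _) = fun t => F i t + \sum_(j <- r) F j t).
  exact: banach_continuousD.
by apply/funext => t; rewrite big_cons.
Qed.

(** Continuity is asked entrywise and on all of R, invertibility on [0, 1] only, so that subspace
    topologies stay out of the constructions. *)
Definition homotopic1 k (U : 'M[A]_k) := exists g : R -> 'M[A]_k,
  [/\ forall i j, continuous (fun t => g t i j),
      forall t, 0 <= t -> t <= 1 -> Defs.Inv (g t), g 0 = U & g 1 = 1%:M].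

Lemma InvM k (U V : 'M[A]_k) : Defs.Inv U -> Defs.Inv V -> Defs.Inv (U *m V).
Proof.
move=> [U' [UU' U'U]] [V' [VV' V'V]]; exists (V' *m U'); split.
  by rewrite mulmxA -(mulmxA U) VV' mulmx1.
by rewrite mulmxA -(mulmxA V') U'U mulmx1.
Qed.

Lemma Inv_id k : Defs.Inv (1%:M : 'M[A]_k).
Proof. by exists 1%:M; rewrite mulmx1. Qed.

Lemma mulmx_continuous k (g h : R -> 'M[A]_k) :
  (forall i j, continuous (fun t => g t i j)) ->
  (forall i j, continuous (fun t => h t i j)) ->
  forall i j, continuous (fun t => (g t *m h t) i j).
Proof.
move=> gc hc i j.
rewrite (_ : (fun _ => _) = fun t => \sum_l g t i l * h t l j).
  by apply: continuous_sum => l; apply: banach_continuousM.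
by apply/funext => t; rewrite mxE.
Qed.

Lemma homotopic1M k (U V : 'M[A]_k) :
  homotopic1 U -> homotopic1 V -> homotopic1 (U *m V).
Proof.
move=> [g [gc gI g0 g1]] [h [hc hI h0 h1]]; exists (fun t => g t *m h t); split.
- exact: mulmx_continuous.
- by move=> t t0 t1; apply: InvM; [exact: gI|exact: hI].
- by rewrite g0 h0.
- by rewrite g1 h1 mulmx1.
Qed.

Let onem_continuous (a : A) : continuous (fun t : R => (1 - t)%:C *: a).
Proof.
apply: banach_continuousZ; apply: continuous_complex => t; last exact: cvg_cst.
by apply: cvgB; [exact: cvg_cst|exact: cvg_id].
Qed.

Let eq_continuous (p q : R -> A) : continuous p -> p =1 q -> continuous q.
Proof. by move=> pc /funext <-. Qed.

Let block_continuous m1 m2 (a : R -> 'M[A]_m1)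
    (b : R -> 'M[A]_(m1, m2)) (c : R -> 'M[A]_(m2, m1)) (d : R -> 'M[A]_m2) :
  (forall i j, continuous (fun t => a t i j)) ->
  (forall i j, continuous (fun t => b t i j)) ->
  (forall i j, continuous (fun t => c t i j)) ->
  (forall i j, continuous (fun t => d t i j)) ->
  forall i j, continuous (fun t => block_mx (a t) (b t) (c t) (d t) i j).
Proof.
move=> ac bc cc dc i j; rewrite -(fintype.splitK i) -(fintype.splitK j).
case: (fintype.split i) => i'; case: (fintype.split j) => j' /=;
  [apply: eq_continuous (ac i' j') _|apply: eq_continuous (bc i' j') _
  |apply: eq_continuous (cc i' j') _|apply: eq_continuous (dc i' j') _] => t;
  by rewrite ?(block_mxEul, block_mxEur, block_mxEdl, block_mxEdr).
Qed.

Let cst_mx_continuous m n (M : 'M[A]_(m, n)) i j : continuous (fun t : R => M i j).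
Proof. by move=> t; exact: cvg_cst. Qed.

Let onem_mx_continuous m n (M : 'M[A]_(m, n)) i j :
  continuous (fun t : R => ((1 - t)%:C%:A *: M) i j).
Proof.
rewrite (_ : (fun _ => _) = fun t : R => (1 - t)%:C *: M i j).
  exact: onem_continuous.
by apply/funext => t; rewrite mxE mulr_algl.
Qed.

Lemma homotopic1_lower m n (c : 'M[A]_(n, m)) : homotopic1 (block_mx 1%:M 0 c 1%:M).
Proof.
exists (fun t => block_mx 1%:M 0 ((1 - t)%:C%:A *: c) 1%:M); split.
- by apply: block_continuous => i j; [exact: cst_mx_continuous..|
    exact: onem_mx_continuous|exact: cst_mx_continuous].
- move=> t _ _; exists (block_mx 1%:M 0 (- ((1 - t)%:C%:A *: c)) 1%:M).
  by rewrite !mulmx_block !mulmx0 !mul0mx !mulmx1 !mul1mx !addr0 !add0r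
    ?subrr ?addNr -scalar_mx_block.
- by rewrite subr0 scale1r scale1r.
- by rewrite subrr !scale0r -scalar_mx_block.
Qed.

Lemma homotopic1_upper m n (b : 'M[A]_(m, n)) : homotopic1 (block_mx 1%:M b 0 1%:M).
Proof.
exists (fun t => block_mx 1%:M ((1 - t)%:C%:A *: b) 0 1%:M); split.
- by apply: block_continuous => i j; [exact: cst_mx_continuous|
    exact: onem_mx_continuous|exact: cst_mx_continuous..].
- move=> t _ _; exists (block_mx 1%:M (- ((1 - t)%:C%:A *: b)) 0 1%:M).
  by rewrite !mulmx_block !mulmx0 !mul0mx !mulmx1 !mul1mx !addr0 !add0r
    ?subrr ?addNr -scalar_mx_block.
- by rewrite subr0 scale1r scale1r.
- by rewrite subrr !scale0r -scalar_mx_block.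
Qed.

Lemma Inv_diag m n (a : 'M[A]_m) (d : 'M[A]_n) :
  Defs.Inv (block_mx a 0 0 d) <-> Defs.Inv a /\ Defs.Inv d.
Proof.
split=> [[W]|[[a' [aa' a'a]] [d' [dd' d'd]]]].
  rewrite -(submxK W) !mulmx_block !mulmx0 !mul0mx !addr0 !add0r !scalar_mx_block.
  move=> [/eq_block_mx[al _ _ dl] /eq_block_mx[ar _ _ dr]].
  by split; [exists (ulsubmx W)|exists (drsubmx W)].
exists (block_mx a' 0 0 d').
by rewrite !mulmx_block !mulmx0 !mul0mx !addr0 !add0r aa' a'a dd' d'd -scalar_mx_block.
Qed.

Lemma homotopic1_diag m n (a : 'M[A]_m) (d : 'M[A]_n) :
  homotopic1 a -> homotopic1 d -> homotopic1 (block_mx a 0 0 d).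
Proof.
move=> [g [gc gI g0 g1]] [h [hc hI h0 h1]].
exists (fun t => block_mx (g t) 0 0 (h t)); split.
- by apply: block_continuous => // i j; exact: cst_mx_continuous.
- by move=> t t0 t1; apply/Inv_diag; split; [exact: gI|exact: hI].
- by rewrite g0 h0.
- by rewrite g1 h1 -scalar_mx_block.
Qed.

Lemma homotopic1_id k : homotopic1 (1%:M : 'M[A]_k).
Proof.
by exists (fun=> 1%:M); split=> // *; exact: Inv_id.
Qed.

Lemma homotopic1_Inv k (U : 'M[A]_k) : homotopic1 U -> Defs.Inv U.
Proof. by move=> [g [_ gI <- _]]; exact: gI. Qed.

Lemma Inv_scalar (a : A) : Defs.Inv (a%:M : 'M[A]_1) <-> invertible a.
Proof.
split=> [[V [aV Va]]|[b [ab ba]]]; last first.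
  by exists b%:M; rewrite -!scalar_mxM ab ba.
move: aV Va; rewrite [V]mx11_scalar -!scalar_mxM => /matrixP/(_ 0 0).
rewrite !mxE eqxx !mulr1n => aV /matrixP/(_ 0 0).
by rewrite !mxE eqxx !mulr1n => Va; exists (V 0 0).
Qed.

(** * Gaussian elimination when the invertible elements are dense and connected *)

Section StableRank.
Hypothesis invertible_dense : forall a (e : R[i]), 0 < e ->
  exists2 b, invertible b & N (b - a) < e.
Hypothesis invertible_connected : forall a, invertible a ->
  exists p : R -> A, [/\ continuous p,
    forall t, 0 <= t -> t <= 1 -> invertible (p t), p 0 = a & p 1 = 1].

Let homotopic1_scalar (a : A) : invertible a -> homotopic1 (a%:M : 'M[A]_1).
Proof.
move=> /invertible_connected[p [pc pI p0 p1]]; exists (fun t => (p t)%:M); split.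
- move=> i j; rewrite !ord1; apply: eq_continuous pc _ => t.
  by rewrite mxE eqxx mulr1n.
- by move=> t t0 t1; apply/Inv_scalar; exact: pI.
- by rewrite p0.
- by rewrite p1.
Qed.

(* Gaussian elimination: moving the corner entry by a small amount makes it
   invertible, and this amounts to multiplying by a triangular matrix. *)
Lemma Inv_homotopic1 m (U : 'M[A]_m) : Defs.Inv U -> homotopic1 U.
Proof.
elim: m => [|m IHm] in U *; first by rewrite [U]thinmx0 -[0](thinmx0 1%:M) => _;
  exact: homotopic1_id.
rewrite -[m.+1]/(1 + m)%N in U * => -[V [UV VU]].
move: UV VU; rewrite -(submxK U) -(submxK V) mulmx_block.
set a := ulsubmx U; set b := ursubmx U; set c := dlsubmx U; set d := drsubmx U.
rewrite [a]mx11_scalar [ulsubmx V]mx11_scalar.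
set a0 : A := a 0 0; set v0 : A := ulsubmx V 0 0; set v' := dlsubmx V.
move=> UV VU; have UI : Defs.Inv (block_mx a0%:M b c d).
  by exists (block_mx v0%:M (ursubmx V) v' (drsubmx V)); rewrite mulmx_block.
move: UV; rewrite scalar_mx_block => /eq_block_mx[UV0 _ UV1 _].
(* This closeness of a1 to a0 makes [1 + v0 * e] invertible by a Neumann series. *)
have vpos : 0 < (1 + N v0)^-1 by rewrite invr_gt0 ltr_pwDl.
have [a1 a1I a1P] := invertible_dense a0 vpos; pose e := a1 - a0.
have [x [ex xe]] : invertible (1 + v0 * e).
  have -> : 1 + v0 * e = 1 - (v0 * - e) by rewrite mulrN opprK.
  apply: neumann; rewrite (le_lt_trans (banach_normM _ _))// banach_normN.
  have : (1 + N v0) * N e < 1 by rewrite mulrC -ltr_pdivlMr ?ltr_pwDl// mul1r.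
  by apply: le_lt_trans; rewrite ler_wpM2r// lerDr.
(* Z is the identity plus the first column of the inverse V times the row (e, 0). As U sends that
   column to the first unit vector, [U *m Z] differs from U only by e in the corner. Y is the
   inverse of Z, factored so that its homotopy to 1 is visible. *)
pose Z : 'M[A]_(1 + m) := block_mx (1 + v0 * e)%:M 0 (v' *m e%:M) 1%:M.
pose Y : 'M[A]_(1 + m) :=
  block_mx 1%:M 0 (- (v' *m e%:M)) 1%:M *m block_mx x%:M 0 0 1%:M.
have ZY : Z *m Y = 1%:M.
  rewrite /Z /Y mulmx_block !mulmx0 !mul0mx !mulmx1 !mul1mx !addr0 !add0r.
  rewrite mulmx_block !mulmx0 !mul0mx !mulmx1 !mul1mx !addr0 !add0r.
  by rewrite mulNmx subrr -scalar_mxM ex -scalar_mx_block.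
have UZ : block_mx a0%:M b c d *m Z = block_mx a1%:M b c d.
  rewrite /Z.
  have ZE : (1 + v0 * e)%:M = 1%:M + v0%:M *m e%:M :> 'M[A]_1.
    by rewrite -scalar_mxM -raddfD.
  rewrite mulmx_block !mulmx0 !mulmx1 !add0r !mulmxA ZE !mulmxDr !mulmx1 !mulmxA.
  rewrite -!addrA -!mulmxDl UV0 UV1 mul1mx mul0mx addr0 -raddfD/=.
  by rewrite /e addrCA subrr addr0.
have YH : homotopic1 Y.
  apply: homotopic1M; first exact: homotopic1_lower.
  by apply: homotopic1_diag (homotopic1_id _); apply: homotopic1_scalar;
    exists (1 + v0 * e).
have ZI : Defs.Inv Z.
  have [W [YW WY]] := homotopic1_Inv YH.
  by exists Y; split=> //; rewrite -[Z]mulmx1 -YW 2!mulmxA -(mulmxA Y) ZY mulmx1.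
rewrite -[block_mx _ _ _ _]mulmx1 -ZY mulmxA UZ; apply: homotopic1M YH.
have [y [a1y ya1]] := a1I.
(* The lower block is the Schur complement of a1; it has size m, so the induction hypothesis applies
   to it. *)
pose D : 'M[A]_(1 + m) := block_mx a1%:M 0 0 (d - c *m y%:M *m b).
have e1 : a1%:M *m (y%:M *m b) = b by rewrite mulmxA -scalar_mxM a1y mul1mx.
have e2 : c *m y%:M *m a1%:M = c by rewrite -mulmxA -scalar_mxM ya1 mulmx1.
have DE : D = block_mx 1%:M 0 (- (c *m y%:M)) 1%:M *m block_mx a1%:M b c d
    *m block_mx 1%:M (- (y%:M *m b)) 0 1%:M.
  rewrite mulmx_block !mul0mx !mul1mx !addr0 !mulNmx e2 addNr.
  rewrite mulmx_block !mulmx0 !mulmx1 !addr0 !mul0mx !add0r mulmxN e1 addNr.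
  by rewrite addrC.
have /Inv_diag[_ dI] : Defs.Inv D.
  rewrite DE; apply: InvM; last exact: homotopic1_Inv (homotopic1_upper _).
  apply: InvM; first exact: homotopic1_Inv (homotopic1_lower _).
  by rewrite -UZ; exact: InvM.
have -> : block_mx a1%:M b c d = block_mx 1%:M 0 (c *m y%:M) 1%:M *m D
    *m block_mx 1%:M (y%:M *m b) 0 1%:M.
  rewrite mulmx_block !mul0mx !mul1mx !addr0 !mulmx0 !add0r.
  rewrite mulmx_block !mulmx0 !mulmx1 !addr0 e1 e2 mulmxA.
  by rewrite [c *m _ *m b + _]addrC subrK.
apply: homotopic1M (homotopic1_upper _); apply: homotopic1M.
  exact: homotopic1_lower.
by apply: homotopic1_diag; [exact: homotopic1_scalar|exact: IHm].
Qed.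

Lemma Inv_stabilize m k (mk : (m <= k)%N) (U : 'M[A]_m) :
  Defs.Inv U -> Defs.Inv (stabilize mk U).
Proof.
rewrite /stabilize => UI; move: (subnKC mk); move: (k - m)%N => l E.
case: k / E mk => _; rewrite castmx_id.
by apply/Inv_diag; split=> //; exact: Inv_id.
Qed.

Lemma K1_equiv_total (U V : InvInf A) : K1_equiv U V.
Proof.
pose k := (maxn (inv_size U) (inv_size V)).+1.
have Uk : (inv_size U < k)%N by rewrite ltnS leq_maxl.
have Vk : (inv_size V < k)%N by rewrite ltnS leq_maxr.
have stabH (W : InvInf A) (Wk : (inv_size W <= k)%N) :
    homotopic1 (stabilize Wk (inv_mx W)).
  by apply: Inv_homotopic1; apply: Inv_stabilize; exact: inv_mxP.
have [g [gc gI g0 g1]] := stabH U (ltnW Uk).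
have [h [hc hI h0 h1]] := stabH V (ltnW Vk).
(* The path contracting the first matrix to 1, times the reversed path of the second, runs from the
   one to the other. *)
exists k, Uk, Vk, (fun t => g t *m h (1 - t)); split.
- apply: continuous_subspaceT; apply: mx_continuousP; apply: mulmx_continuous => //.
  move=> i j t.
  apply: (@continuous_comp R R A (fun t => 1 - t) (fun t => h t i j)); last exact: hc.
  by apply: cvgB; [exact: cvg_cst|exact: cvg_id].
- move=> t; rewrite in_itv/= => /andP[t0 t1].
  by apply: InvM; [exact: gI|apply: hI; rewrite ?subr_ge0// lerBlDr lerDl].
- by rewrite subr0 h1 mulmx1.
- by rewrite subrr g1 h0 mul1mx.
Qed.

Lemma K1_trivial : K1 A = [set K1_zero A].
Proof.
have KE (U : InvInf A) : K1_class U = setT.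
  by apply/seteqP; split=> V _; [exact: I|exact: K1_equiv_total].
rewrite /K1_zero KE; apply/seteqP; split=> [_ [U _ <-]|_ ->]; first by rewrite KE.
by exists (InInv (ltn0Sn 0) (Inv1 A)); rewrite ?KE.
Qed.

End StableRank.

End Paths.

(** * Isolated zeros *)

Section Analytic.
Context (K : numFieldType) (r : K).
Implicit Types (f g : K -> K).

(* [f] has a Taylor expansion with remainders: [F k w] is what is left of [f w]
   after removing the first k terms and dividing by w ^+ k. *)
Definition analytic f := exists (C rho : K) (F : nat -> K -> K),
  [/\ 0 <= C, 0 <= rho,
      forall k w, `|w| < r -> `|F k w| <= C * rho ^+ k,
      forall k w, `|w| < r -> F k w = F k 0 + w * F k.+1 w & F 0 = f].

Lemma analytic_cst (c : K) : analytic (fun=> c).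
Proof.
exists `|c|, 0, (fun k _ => if k is 0 then c else 0); split=> //.
- by case=> [|k] w _; rewrite ?mulr1// normr0 exprS mul0r mulr0.
- by case=> [|k] w _; rewrite mulr0 addr0.
Qed.

Lemma analyticD f g : analytic f -> analytic g -> analytic (fun w => f w + g w).
Proof.
move=> [C [rho [F [C0 rho0 Fle FE <-]]]] [D [sig [G [D0 sig0 Gle GE <-]]]].
exists (C + D), (rho + sig), (fun k w => F k w + G k w); split=> //.
- exact: addr_ge0.
- exact: addr_ge0.
- move=> k w wr; rewrite (le_trans (ler_normD _ _))// mulrDl lerD//.
    rewrite (le_trans (Fle _ _ wr))// ler_wpM2l// lerXn2r ?nnegrE ?addr_ge0//.
    by rewrite lerDl.
  rewrite (le_trans (Gle _ _ wr))// ler_wpM2l// lerXn2r ?nnegrE ?addr_ge0//.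
  by rewrite lerDr.
- by move=> k w wr; rewrite FE// GE// mulrDr addrACA.
Qed.

(** The Taylor terms [F i 0] are peeled off f and each is paired with the remainder of g of
    complementary order. The resulting bounds sum to C D times the sum of the rho^i sig^(k-i), which
    the binomial expansion of (rho + sig)^k dominates. *)
Lemma analyticM f g : 0 < r ->
  analytic f -> analytic g -> analytic (fun w => f w * g w).
Proof.
move=> r0 [C [rho [F [C0 rho0 Fle FE <-]]]] [D [sig [G [D0 sig0 Gle GE <-]]]].
exists (C * D), (rho + sig),
  (fun k w => F k w * G 0 w + \sum_(i < k) F i 0 * G (k - i)%N w); split=> //.
- exact: mulr_ge0.
- exact: addr_ge0.
- move=> k w wr.
  have z0 : `|0 : K| < r by rewrite normr0.
  have FG i j x y : `|x| < r -> `|y| < r ->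
      `|F i x * G j y| <= C * D * (rho ^+ i * sig ^+ j).
    move=> xr yr; rewrite normrM mulrACA ler_pM//; first exact: Fle.
    exact: Gle.
  apply: (@le_trans _ _ (C * D * \sum_(i < k.+1) rho ^+ i * sig ^+ (k - i))).
    rewrite big_ord_recr/= subnn [in leRHS]addrC mulrDr.
    rewrite (le_trans (ler_normD _ _))// lerD ?FG// mulr_sumr.
    rewrite (le_trans (ler_norm_sum _ _ _))// ler_sum// => i _.
    exact: FG.
  rewrite ler_wpM2l ?mulr_ge0// addrC exprDn.
  apply: ler_sum => i _; rewrite mulrC -[leLHS]mulr1n.
  rewrite ler_wpMn2l ?mulr_ge0 ?exprn_ge0// bin_gt0 -ltnS.
  exact: ltn_ord.
- move=> k w wr.
  have -> : \sum_(i < k) F i 0 * G (k - i)%N w = \sum_(i < k) F i 0 * G (k - i)%N 0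
      + w * \sum_(i < k) F i 0 * G (k.+1 - i)%N w.
    rewrite mulr_sumr -big_split/=; apply: eq_bigr => i _.
    by rewrite GE// subSn ?(ltnW (ltn_ord i))//; ring.
  rewrite big_ord_recr/= subSn// subnn FE// [G 0 w]GE//.
  by ring.
- by apply/funext => w; rewrite big_ord0 addr0.
Qed.

Lemma analytic_sum (I : Type) (s : seq I) (P : pred I) (f : I -> K -> K) :
  (forall i, analytic (f i)) -> analytic (fun w => \sum_(i <- s | P i) f i w).
Proof.
move=> fa; elim: s => [|i s IHs].
  rewrite (_ : (fun _ => _) = (fun=> 0)); first exact: analytic_cst.
  by apply/funext => w; rewrite big_nil.
rewrite (_ : (fun _ => _) = (fun w => (if P i then f i w else 0) +
    \sum_(j <- s | P j) f j w)).
  by apply: analyticD IHs; case: (P i) => //; exact: analytic_cst.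
by apply/funext => w; rewrite big_cons; case: (P i); rewrite ?add0r.
Qed.

Lemma analytic_prod (I : Type) (s : seq I) (P : pred I) (f : I -> K -> K) : 0 < r ->
  (forall i, analytic (f i)) -> analytic (fun w => \prod_(i <- s | P i) f i w).
Proof.
move=> r0 fa; elim: s => [|i s IHs].
  rewrite (_ : (fun _ => _) = (fun=> 1)); first exact: analytic_cst.
  by apply/funext => w; rewrite big_nil.
rewrite (_ : (fun _ => _) = (fun w => (if P i then f i w else 1) *
    \prod_(j <- s | P j) f j w)).
  by apply: analyticM IHs => //; case: (P i) => //; exact: analytic_cst.
by apply/funext => w; rewrite big_cons; case: (P i); rewrite ?mul1r.
Qed.

Lemma analytic_det n (M : K -> 'M[K]_n) : 0 < r ->
  (forall i j, analytic (fun w => M w i j)) -> analytic (fun w => \det (M w)).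
Proof.
move=> r0 Ma; apply: analytic_sum => s; apply: analyticM => //.
  exact: analytic_cst.
by apply: analytic_prod => // i; exact: Ma.
Qed.


End Analytic.

(** Either some Taylor coefficient [F k 0] is nonzero, and the first such one dominates near 0, or
    [f w = w ^+ n * F n w] for every n. In the second case |f w| <= C (|w| rho)^n for all n, which
    forces f to vanish near 0 against the hypothesis. *)
Lemma analytic_isolated_zeros (R : realType) (r : R[i]) (f : R[i] -> R[i]) :
  0 < r -> analytic r f ->
  (forall e, 0 < e -> exists2 w, `|w| < e & f w != 0) ->
  exists2 e, 0 < e & forall w, w != 0 -> `|w| < e -> f w != 0.
Proof.
move=> r0 [C [rho [F [C0 rho0 Fle FE <-]]]] Fn0.
have Fexp k : (forall j, (j < k)%N -> F j 0 = 0) ->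
    forall w, `|w| < r -> F 0 w = w ^+ k * F k w.
  elim: k => [|k IHk] Fj w wr; first by rewrite mul1r.
  rewrite IHk// => [|j jk]; last by apply: Fj; exact: ltnW.
  by rewrite FE// Fj// add0r mulrA -exprSr.
have [ex|nF] := pselect (exists k, F k 0 != 0).
  case: (ex_minnP ex) => k Fk kmin.
  have c0 : 0 < 1 + C * rho ^+ k.+1 by rewrite ltr_pwDl// mulr_ge0// exprn_ge0.
  (* Below this radius [w * F k.+1 w] is too small to cancel [F k 0]. *)
  have [d [d0 dr dF]] : exists d, [/\ 0 < d, d <= r & d <= `|F k 0| / (1 + C * rho ^+ k.+1)].
    by apply: pos_lower_bound => //; rewrite divr_gt0 ?normr_gt0.
  exists d => // w w0 wd; have wr := lt_le_trans wd dr.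
  rewrite (Fexp k)// => [|j jk]; last first.
    by apply/eqP; apply: contraTT jk => /kmin; rewrite -leqNgt.
  rewrite mulf_neq0 ?expf_neq0// FE//; apply/eqP => /eqP; rewrite addr_eq0 => /eqP Fk0.
  have : `|F k 0| <= `|w| * (1 + C * rho ^+ k.+1).
    by rewrite Fk0 normrN normrM ler_wpM2l// (le_trans (Fle _ _ wr))// lerDr.
  rewrite -ler_pdivrMr// => /(le_lt_trans (y := `|w|)) /(_ (lt_le_trans wd dF)).
  by rewrite ltxx.
have F0 k : F k 0 = 0 by apply/eqP; apply: contrapT => /negP Fk; apply: nF; exists k.
have [d [d0 dr dF]] := pos_lower_bound r0 (divr_gt0 ltr01 (ltr_pwDl ltr01 rho0)).
have [w wd Fw] := Fn0 _ d0; have wr := lt_le_trans wd dr.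
have q1 : `|w| * rho < 1.
  have := lt_le_trans wd dF; rewrite ltr_pdivlMr ?ltr_pwDl//; apply: le_lt_trans.
  by rewrite ler_wpM2l// lerDr.
have c0 : 0 < 1 + C by rewrite ltr_pwDl.
have [|n nP] := expr_small (mulr_ge0 (normr_ge0 w) rho0) q1 (e := `|F 0 w| / (1 + C)).
  by rewrite divr_gt0// normr_gt0.
have := nP n (leqnn n); rewrite ltr_pdivlMr//.
have : `|F 0 w| <= (`|w| * rho) ^+ n * (1 + C).
  rewrite (Fexp n)// normrM normrX exprMn -mulrA ler_wpM2l ?exprn_ge0//.
  by rewrite (le_trans (Fle _ _ wr))// mulrC ler_wpM2l ?exprn_ge0// lerDr.
by move=> /le_lt_trans h /h; rewrite ltxx.
Qed.

(** * The Hahn-Banach theorem *)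

Section HahnBanach.
Context (R : realType) (V : lmodType R[i]) (p : V -> R).
Hypothesis pD : forall x y, p (x + y) <= p x + p y.
Hypothesis pZ : forall (t : R) x, p (t%:C *: x) = `|t| * p x.

Let p0 : p 0 = 0.
Proof. by have := pZ 0 0; rewrite scaler0 normr0 mul0r. Qed.

Let pN x : p (- x) = p x.
Proof. by have := pZ (-1) x; rewrite rmorphN1 scaleN1r normrN normr1 mul1r. Qed.

(* Graphs of p-dominated real-linear functionals on real subspaces. *)
Let dominated (G : set (V * R)) :=
  (forall t x y r s, G (x, r) -> G (y, s) -> G (t%:C *: x + y, t * r + s)) /\
  (forall x r, G (x, r) -> r <= p x).

Let dominated_ext (G : set (V * R)) v : dominated G -> G !=set0 ->
  exists c : R, dominated [set z | exists x r t, G (x, r) /\ z = (x + t%:C *: v, r + t * c)].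
Proof.
move=> [GL Gp] [[x0 r0] G0].
have GB x r y s : G (x, r) -> G (y, s) -> r - p (x - v) <= p (y + v) - s.
  move=> Gx Gy; have := Gp _ _ (GL 1 _ _ _ _ Gx Gy).
  rewrite scale1r mul1r; have := pD (x - v) (y + v).
  by rewrite addrACA addNr addr0; lra.
have GZ x r t : G (x, r) -> G (t%:C *: x, t * r).
  move=> Gx; have G00 : G (0, 0).
    have := GL (-1) _ _ _ _ Gx Gx.
    by rewrite rmorphN1 scaleN1r mulN1r !addNr.
  by have := GL t _ _ _ _ Gx G00; rewrite !addr0.
(* The value c at v must lie between every [r - p (x - v)] and every [p (y + v) - s]; by [GB] the
   supremum of the former does. *)
pose S := [set z | exists x r, G (x, r) /\ z = r - p (x - v)].
have Sub : has_sup S.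
  split; first by exists (r0 - p (x0 - v)), x0, r0.
  by exists (p (x0 + v) - r0) => _ [x [r [Gx ->]]]; exact: GB.
exists (sup S); split.
  move=> t x y r s [x1 [r1 [t1 [G1 [-> ->]]]]] [x2 [r2 [t2 [G2 [-> ->]]]]].
  exists (t%:C *: x1 + x2), (t * r1 + r2), (t * t1 + t2); split; first exact: GL.
  congr (_, _); last by ring.
  by rewrite scalerDr addrACA rmorphD rmorphM/= scalerDl scalerA.
move=> _ _ [x [r [t [Gx [-> ->]]]]].
have [t0|t0|->] := ltgtP t 0; last by rewrite mul0r scale0r !addr0; exact: Gp.
- have u0 : 0 < - t by rewrite oppr_gt0.
  have : ((- t)^-1 * r) - p ((- t)^-1%:C *: x - v) <= sup S.
    by apply: sup_upper_bound => //; exists ((- t)^-1%:C *: x), ((- t)^-1 * r);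
      split=> //; exact: GZ.
  have -> : (- t)^-1%:C *: x - v = (- t)^-1%:C *: (x + t%:C *: v).
    rewrite scalerDr scalerA -rmorphM/= invrN mulNr mulVf ?lt_eqF//.
    by rewrite rmorphN1 scaleN1r.
  rewrite pZ ger0_norm ?invr_ge0 ?(ltW u0)// -mulrBr mulrC ler_pdivrMr//.
  by rewrite mulrN; lra.
- have : sup S <= p (t^-1%:C *: x + v) - t^-1 * r.
    apply: ge_sup; first by case: Sub.
    by move=> _ [y [s [Gy ->]]]; apply: GB => //; exact: GZ.
  have -> : t^-1%:C *: x + v = t^-1%:C *: (x + t%:C *: v).
    by rewrite scalerDr scalerA -rmorphM/= mulVf ?gt_eqF// scale1r.
  rewrite pZ ger0_norm ?invr_ge0 ?(ltW t0)// -mulrBr mulrC ler_pdivlMr//.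
  by rewrite mulrC; lra.
Qed.

Lemma hahn_banach_real x0 : exists g : V -> R,
  [/\ forall t x y, g (t%:C *: x + y) = t * g x + g y,
      forall x, g x <= p x & g x0 = p x0].
Proof.
pose P G := G = set0 \/ dominated G /\ G (x0, p x0).
have [|A [AP Amax]] := @Zorn_bigcup _ P.
  move=> F FP Ftot.
  have [[G [FG [z Gz]]]|nF] := pselect (exists G, F G /\ G !=set0); last first.
    left; apply/seteqP; split=> // z [G FG Gz]; apply: nF; exists G; split=> //.
    by exists z.
  have FPn H w : F H -> H w -> dominated H /\ H (x0, p x0).
    by move=> /FP[->//|].
  right; split; last by exists G => //; have [_] := FPn G z FG Gz.
  split=> [t x y r s [G1 FG1 Gx] [G2 FG2 Gy]|x r [G1 FG1 Gx]]; last first.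
    by have [[_ +] _] := FPn _ _ FG1 Gx; exact.
  have [G12|G21] := Ftot _ _ FG1 FG2.
    exists G2 => //; have [[+ _] _] := FPn _ _ FG2 Gy; apply => //; exact: G12.
  exists G1 => //; have [[+ _] _] := FPn _ _ FG1 Gx; apply => //; exact: G21.
have [A0|[Ad Ax0]] := AP.
  pose B := [set z : V * R | exists t : R, z = (t%:C *: x0, t * p x0)].
  have Bx0 : B (x0, p x0) by exists 1; rewrite scale1r mul1r.
  case: (Amax B).
    split; last by move=> h; have := h _ Bx0; rewrite A0.
    by rewrite A0 => z.
  right; split=> //; split.
    move=> t x y r s [t1 [-> ->]] [t2 [-> ->]]; exists (t * t1 + t2).
    by rewrite rmorphD rmorphM/= scalerDl scalerA mulrDl mulrA.
  move=> _ _ [t [-> ->]]; rewrite pZ; apply: ler_wpM2r; last exact: ler_norm.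
  by have := pD x0 (- x0); rewrite subrr p0 pN; lra.
have [AL Ap] := Ad.
have Adom v : exists r, A (v, r).
  apply: contrapT => nv; have [|c Bd] := dominated_ext v Ad; first by exists (x0, p x0).
  have A00 : A (0, 0).
    by have := AL (-1) _ _ _ _ Ax0 Ax0; rewrite rmorphN1 scaleN1r mulN1r !addNr.
  apply: (Amax [set z | exists x r t, A (x, r) /\ z = (x + t%:C *: v, r + t * c)]).
    split=> [[x r] Axr|h].
      by exists x, r, 0; rewrite scale0r mul0r !addr0.
    by apply: nv; exists c; apply: h; exists 0, 0, 1; rewrite scale1r mul1r !add0r.
  by right; split=> //; exists x0, (p x0), 0; rewrite scale0r mul0r !addr0.
have [g gA] := choice Adom.
have Auniq x r s : A (x, r) -> A (x, s) -> r = s.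
  move=> Ar As; have h a b : A (x, a) -> A (x, b) -> a <= b.
    move=> Aa Ab; have := Ap _ _ (AL (-1) _ _ _ _ Ab Aa).
    by rewrite rmorphN1 scaleN1r addNr mulN1r p0; lra.
  by apply/eqP; rewrite eq_le !h.
exists g; split=> [t x y|x|].
- by apply: Auniq (gA _) _; exact: AL.
- exact: Ap (gA x).
- exact: Auniq (gA _) Ax0.
Qed.

End HahnBanach.

Lemma bounded_linear_operator (R : realType) (X Y : normedModType R[i]) (f : X -> Y) :
  linear f -> (exists c : R[i], forall x, `|f x| <= c * `|x|) ->
  exists T : operator X Y, T =1 f.
Proof.
move=> fl [c fc]; pose L := GRing.isLinear.Build R[i] X Y _ f fl.
pose f' : {linear X -> Y} := HB.pack f L.
have fcont : continuous f.
  apply: (@bounded_linear_continuous _ _ _ f'); apply/linear_boundedP.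
  near=> r => x /=; rewrite (le_trans (fc x))//.
  have [->|x0] := eqVneq x 0; first by rewrite normr0 !mulr0.
  rewrite ler_wpM2r//; apply: (@le_trans _ _ `|c|).
    rewrite real_ler_norm//; have : 0 <= c * `|x| by rewrite (le_trans _ (fc x)).
    by rewrite pmulr_lge0 ?normr_gt0// => /ger0_real.
  by near: r; apply: nbhs_pinfty_ge; rewrite normr_real.
have fP : f \in @operator_pred _ X Y by apply/asboolP.
by exists (Operator fP).
Unshelve. all: by end_near. Qed.

Lemma hahn_banach (R : realType) (V : normedModType R[i]) (x0 : V) : `|x0| = 1 ->
  exists f : operator V R[i]^o, f x0 = 1 /\ forall x, `|f x| <= `|x|.
Proof.
move=> x01; pose p (x : V) : R := complex.Re `|x|.
have pE x : (p x)%:C = `|x| by rewrite /p RRe_real// ger0_real.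
have [|t x|g [gL gp g0]] := @hahn_banach_real R V p _ _ x0.
- by move=> x y; rewrite -lecR rmorphD/= !pE ler_normD.
- by apply/complexI; rewrite rmorphM/= !pE normrZ normc_real//.
have sE (a b : R[i]) : a *: (b : R[i]^o) = a * b by [].
(* The only complex-linear functional with real part g. Its modulus is controlled by rotating x
   until f x is real and nonnegative, hence equal to g. *)
pose f (x : V) : R[i]^o := (g x) +i* (- g ('i *: x)).
have gD x y : g (x + y) = g x + g y by rewrite -[x]scale1r gL mul1r scale1r.
have gZ (t : R) x : g (t%:C *: x) = t * g x.
  have g00 : g 0 = 0 by have := gD 0 0; rewrite addr0; lra.
  by rewrite -[_ *: _]addr0 gL g00 addr0.
have fl : linear f.
  move=> [a b] x y; rewrite /f.
  have e1 : (a +i* b) *: x = a%:C *: x + b%:C *: ('i *: x).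
    by rewrite scalerA -scalerDl [LHS in LHS *: _]complexE/= mulrC.
  have e2 : 'i *: ((a +i* b) *: x) = a%:C *: ('i *: x) + (- b)%:C *: x.
    rewrite e1 scalerDr !scalerA rmorphN/=; congr (_ + _); first by rewrite mulrC.
    by rewrite mulrAC -expr2 sqr_i mulN1r.
  rewrite scalerDr e2 e1 !gD !gZ.
  by apply/eqP; rewrite eq_complex/=; apply/andP; split; apply/eqP; rewrite /=; ring.
have f0 : 1 <= `|f x0|.
  have := normc_ge_Re (f x0); rewrite /f/= g0 /p x01 normr1.
  by [].
have fle x : `|f x| <= `|x|.
  have [->|z0] := eqVneq (f x) 0; first by rewrite normr0.
  pose u := `|f x| / f x.
  have u1 : `|u| = 1 by rewrite normrM normfV normr_id mulfV// normr_eq0.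
  have fu : f (u *: x) = `|f x|.
    have f00 : f 0 = 0 by have := fl (-1) 0 0; rewrite scaler0 addr0 scaleN1r addNr.
    by rewrite -[u *: x]addr0 fl f00 addr0 /u sE divfK.
  have : (g (u *: x))%:C <= `|u *: x| by rewrite -pE lecR.
  by rewrite -[g _]/(complex.Re (f (u *: x))) fu normrZ u1 mul1r RRe_real// ger0_real.
have f0n : f x0 != 0 by rewrite -normr_gt0 (lt_le_trans ltr01 f0).
(* Since [f x0] has modulus at least 1, dividing by it preserves the bound and gives the value 1 at
   x0, so the imaginary part of [f x0] need not be computed. *)
have [||F FE] := @bounded_linear_operator R V R[i]^o (fun x => (f x0)^-1 *: f x).
- by move=> a x y; rewrite fl scalerDr !scalerA mulrC.
- by exists `|(f x0)^-1| => x; rewrite normrZ ler_wpM2l.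
exists F; rewrite !FE; split.
  by rewrite sE mulVf.
move=> x; rewrite FE normrZ normfV mulrC ler_pdivrMr ?normr_gt0//.
by rewrite (le_trans (fle x))// -[leLHS]mulr1 ler_wpM2l.
Qed.

(** * Strictly singular perturbations of the identity *)

Section FiniteRank.
Context (R : realType) (X : banachSpace R).
Implicit Types (P T A S : endo X) (x y u : X) (h f : operator X R[i]^o).

Fact rank1_subproof u h : exists T : endo X, forall x, T x = h x *: u.
Proof.
apply: (@bounded_linear_operator R X X (fun x => h x *: u)).
  by move=> a x y; rewrite linearD linearZ scalerDl scalerA.
exists (opnorm h * `|u|) => x; rewrite normrZ mulrAC ler_wpM2r//.
exact: (le_opnorm h x).
Qed.

Definition rank1 u h : endo X := sval (cid (rank1_subproof u h)).

Lemma rank1E u h x : rank1 u h x = h x *: u.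
Proof. exact: (svalP (cid (rank1_subproof u h))). Qed.

(* Finite-rank idempotents, built by adding one dimension to the range at a time. *)
Inductive finproj : endo X -> Prop :=
| finproj0 : finproj 0
| finprojS P x h : finproj P -> P x = 0 -> `|x| = 1 -> h x = 1 ->
    (forall y, h (P y) = 0) -> finproj (P + rank1 x h).

Lemma endo_addE P T x : (P + T) x = P x + T x. Proof. by []. Qed.

Lemma finproj_idem P : finproj P -> forall y, P (P y) = P y.
Proof.
elim=> [y|{}P x h _ IH Px0 _ hx hP y] //; rewrite !endo_addE !rank1E.
by rewrite !linearD !linearZ/= IH Px0 hP hx scaler0 addr0 add0r [_ *: 1]mulr1.
Qed.

Lemma finproj_kerS P x h y : P x = 0 -> (forall y, P (P y) = P y) ->
  h x = 1 -> (P + rank1 x h) y = 0 <-> P y = 0 /\ h y = 0.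
Proof.
move=> Px0 idP hx; rewrite endo_addE rank1E; split=> [e|[-> ->]]; last first.
  by rewrite scale0r addr0.
have Py0 : P y = 0.
  by have := congr1 P e; rewrite linearD linearZ/= idP Px0 scaler0 addr0 linear0.
split=> //; move: e; rewrite Py0 add0r => /(congr1 h).
by rewrite linearZ/= hx linear0 [_ *: 1]mulr1.
Qed.

Lemma finproj_sum P : finproj P -> exists (k : nat) (x : 'I_k -> X)
  (h : 'I_k -> operator X R[i]^o), forall y, P y = \sum_i h i y *: x i.
Proof.
elim=> [|{}P x h _ [k [xs [hs PE]]] _ _ _ _].
  exists 0%N, (fun=> 0), (fun=> 0) => y; rewrite big_ord0//.
exists k.+1, (fun i => if unlift ord0 i is Some j then xs j else x),
  (fun i => if unlift ord0 i is Some j then hs j else h) => y.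
rewrite endo_addE big_ord_recl unlift_none rank1E PE addrC; congr (_ + _).
by apply: eq_bigr => i _; rewrite liftK.
Qed.

Lemma le_endo_norm T x : `|T x| <= `|T| * `|x|.
Proof. exact: le_opnorm. Qed.

End FiniteRank.

(** * Lower bounds on subspaces of finite codimension *)

Section SemiFredholm.
Context (R : realType) (X : banachSpace R).
Variables (T : endo X) (q : R[i]).
Hypothesis (Tss : strictly_singular X X T) (q0 : q != 0).
Let S : endo X := 1 + q *: T.

(* Otherwise unit vectors x_n on which S is tiny can be chosen together with
   biorthogonal functionals, and T is bounded below on their span. *)
Lemma strictly_singular_bounded_below : exists P, finproj P /\
  exists2 c : R[i], 0 < c & forall y, P y = 0 -> c * `|y| <= `|S y|.
Proof.
apply: contrapT => nP.
have small P c : finproj P -> 0 < c ->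
    exists x, [/\ P x = 0, `|x| = 1 & `|S x| < c].
  move=> Pf c0; apply: contrapT => nx; apply: nP; exists P; split=> //.
  exists c => // y Py; rewrite real_leNgt ?normr_real//; last first.
    by rewrite realM ?normr_real ?gtr0_real.
  apply/negP => yS; apply: nx; have y0 : 0 < `|y|.
    rewrite normr_gt0; apply: contraTneq yS => ->.
    by rewrite linear0 normr0 mulr0 ltxx.
  exists (`|y|^-1 *: y); rewrite !linearZ/= Py scaler0 !normrZ ger0_norm ?invr_ge0//.
  by split=> //; [rewrite mulVf// gt_eqF|rewrite mulrC ltr_pdivrMr].
(* The sum stays below 1/2, so |S y| <= |y| / 2 on the span. Since y = S y - q T y, at least |y| / 2
   is left for q T y. *)
pose e (n : nat) : R[i] := 2^-1 ^+ n.+2.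
have e0 n : 0 < e n by rewrite exprn_gt0// invr_gt0.
have /choice[st stP] : forall nP : nat * endo X, exists xh : X * operator X R[i]^o,
    finproj nP.2 -> [/\ nP.2 xh.1 = 0, `|xh.1| = 1, xh.2 xh.1 = 1,
      (forall y, xh.2 (nP.2 y) = 0) &
      forall y, `|xh.2 y| * `|S xh.1| <= e nP.1 * `|y|].
  move=> [n P]/=; have [Pf|] := pselect (finproj P); last by exists (0, 0).
  have c0 : 0 < 1 + `|1 - P| by rewrite ltr_pwDl.
  have [x [Px x1 Sx]] := small P _ Pf (divr_gt0 (e0 n) c0).
  have [f [fx fle]] := hahn_banach x1.
  (* Composing with 1 - P kills the range of P and keeps the value 1 at x, as P x = 0. The norm
     grows by at most the factor [1 + |1 - P|], which the choice of x has already absorbed. *)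
  exists (x, comp_op f (1 - P)) => _.
  have hE y : comp_op f (1 - P) y = f (y - P y) by [].
  split; [exact: Px|exact: x1|by rewrite [LHS]hE Px subr0|move=> y|].
    by rewrite [LHS]hE finproj_idem// subrr linear0.
  move=> y; apply: (@le_trans _ _ (((1 + `|1 - P|) * `|y|) * (e n / (1 + `|1 - P|)))).
    rewrite ler_pM// ?(ltW Sx)// (le_trans (fle _))// (le_trans (le_endo_norm _ _))//.
    by rewrite ler_wpM2r// lerDr.
  by rewrite mulrAC [(1 + _) * (_ / _)]mulrC divfK ?gt_eqF.
pose fix Pn n : endo X := if n is m.+1 then
  Pn m + rank1 (st (m, Pn m)).1 (st (m, Pn m)).2 else 0.
pose x n := (st (n, Pn n)).1; pose h n := (st (n, Pn n)).2.
have PS n : Pn n.+1 = Pn n + rank1 (x n) (h n) by [].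
have Pf n : finproj (Pn n).
  elim: n => [|n IHn]; first exact: finproj0.
  have [Px x1 hx hP _] := stP (n, Pn n) IHn; exact: (finprojS IHn Px x1 hx hP).
have xhP n := stP (n, Pn n) (Pf n); rewrite /= in xhP.
have ran m n y : (m <= n)%N -> Pn m y = y -> Pn n y = y.
  move=> /subnKC <-; elim: (n - m)%N => [|k IHk] Py; first by rewrite addn0.
  have [_ _ _ hP _] := xhP (m + k)%N.
  by rewrite addnS PS endo_addE IHk// rank1E -{2}(IHk Py) hP scale0r addr0.
have ker m n y : (m < n)%N -> Pn n y = 0 -> h m y = 0.
  move=> mn; rewrite -(subnKC mn); elim: (n - m.+1)%N => [|k IHk].
    rewrite addn0 PS; have [Px _ hx _ _] := xhP m.
    by have [H _] := @finproj_kerS _ _ _ _ _ y Px (finproj_idem (Pf m)) hx; move=> /H[].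
  rewrite addnS PS; have [Px _ hx _ _] := xhP (m.+1 + k)%N.
  have [H _] := @finproj_kerS _ _ _ _ _ y Px (finproj_idem (Pf _)) hx.
  by move=> /H[/IHk].
have xran n : Pn n.+1 (x n) = x n.
  by have [Px _ hx _ _] := xhP n; rewrite PS endo_addE rank1E Px add0r [h n _]hx scale1r.
(* For i < j, x j lies in ker P_j, where h i vanishes; for j < i, x j lies in the range of P_i,
   which h i kills by construction. *)
have hx i j : h i (x j) = (i == j)%:R.
  have [_ _ hxi hP _] := xhP i; have [Pxj _ _ _ _] := xhP j.
  have [ij|ij|<-] := ltngtP i j; last exact: hxi.
  - exact: ker ij Pxj.
  - by rewrite -(ran j.+1 i (x j) ij (xran j)); exact: hP.
have PE n y : Pn n y = \sum_(i < n) h i y *: x i.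
  elim: n => [|n IHn]; first by rewrite big_ord0.
  by rewrite PS endo_addE IHn rank1E big_ord_recr.
pose E := [set y | exists n, Pn n y = y].
have Esub : is_subspace E.
  split=> [|a y z [m My] [n Nz]]; first by exists 0%N.
  exists (maxn m n); rewrite operator_linear.
  by rewrite (ran _ _ _ (leq_maxl m n) My) (ran _ _ _ (leq_maxr m n) Nz).
have sume n : \sum_(i < n) e i = 2^-1 - 2^-1 ^+ n.+1.
  elim: n => [|n IHn]; first by rewrite big_ord0 expr1 subrr.
  rewrite big_ord_recr/= IHn /e -addrA; congr (_ + _).
  rewrite [in LHS](exprS _ n.+1); rewrite -[X in - X]mul1r -mulNr -mulrDl.
  by rewrite (exprS _ n.+1) -mulNr; congr (_ * _); rewrite [1]splitr; field.
have SE y : E y -> `|S y| <= 2^-1 * `|y|.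
  move=> [n Py]; have -> : S y = \sum_(i < n) h i y *: S (x i).
    rewrite -{1}Py PE [LHS]linear_sum; apply: eq_bigr => i _; exact: linearZ.
  rewrite (le_trans (ler_norm_sum _ _ _))//.
  apply: (@le_trans _ _ (\sum_(i < n) e i * `|y|)).
    apply: ler_sum => i _; rewrite normrZ.
    by have [_ _ _ _] := xhP i; exact.
  rewrite -mulr_suml ler_wpM2r// sume lerBlDr lerDl exprn_ge0// invr_ge0//.
have q0' : 0 < `|q| by rewrite normr_gt0.
have /(Tss Esub)[n [v Ev]] : bounded_below_on T E.
  exists ((2 * `|q|)^-1); first by rewrite invr_gt0 mulr_gt0.
  move=> y /SE Sy; rewrite mulrC ler_pdivrMr ?mulr_gt0//.
  have SyE : S y = y + q *: T y by [].
  have : `|y| <= 2^-1 * `|y| + `|q| * `|T y|.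
    rewrite -[X in X <= _](_ : `|S y - q *: T y| = _); last by rewrite SyE addrK.
    by rewrite (le_trans (ler_normB _ _))// normrZ lerD.
  rewrite -lerBlDl -{1}[`|y|]mul1r -mulrBl (_ : 1 - 2^-1 = 2^-1); last by field.
  by rewrite ler_pdivrMl// => /le_trans; apply; rewrite mulrA mulrC.
(* Were E spanned by n vectors, n + 1 of the x j would satisfy a nontrivial linear relation, whose
   coefficients the functionals h j all show to be 0. *)
have /choice[a aP] : forall j : 'I_n.+1, exists b : 'I_n -> R[i], x j = \sum_i b i *: v i.
  move=> j; have : E (x j) by exists j.+1.
  by rewrite Ev => -[b _ <-]; exists b.
pose M := \matrix_(j < n.+1, i < n) a j i.
have : kermx M != 0.
  by rewrite kermx_eq0 /row_free neq_ltn ltnS rank_leq_col.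
move=> /rowV0Pn[w /sub_kermxP wM w0]; apply/negP: w0; rewrite negbK.
apply/eqP/rowP => j; rewrite mxE.
have : \sum_(l < n.+1) w 0 l *: x l = 0.
  under eq_bigr do rewrite aP scaler_sumr.
  rewrite exchange_big/= big1// => i _; under eq_bigr do rewrite scalerA.
  rewrite -scaler_suml; move/rowP/(_ i): wM; rewrite !mxE => wMi.
  rewrite (_ : \sum_l w 0 l * a l i = 0) ?scale0r// -[RHS]wMi.
  by apply: eq_bigr => l _; rewrite mxE.
move=> /(congr1 (h j)); rewrite linear0 linear_sum/= => <-.
rewrite (bigD1 j)//= linearZ/= hx eqxx [_ *: _]mulr1 big1 ?addr0// => l lj.
rewrite linearZ/= hx eq_sym; move: lj; rewrite -val_eqE => /negbTE ->; exact: mulr0.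
Qed.

End SemiFredholm.

(** * Correcting an invertible operator on the range of a projection *)

Section Fredholm.
Context (R : realType) (X : banachSpace R).
Implicit Types (P T A S : endo X) (x y u : X) (h f : operator X R[i]^o).

Lemma endoME A S y : (A * S) y = A (S y). Proof. by []. Qed.

Lemma functionalZ h (a : R[i]) y : h (a *: y) = a * h y.
Proof. exact: linearZ. Qed.

Lemma functionalD h x y : h (x + y) = h x + h y.
Proof. exact: linearD. Qed.

Lemma functionalB h x y : h (x - y) = h x - h y.
Proof. exact: linearB. Qed.

Lemma functional_sum h (I : Type) (s : seq I) (F : I -> X) :
  h (\sum_(i <- s) F i) = \sum_(i <- s) h (F i).
Proof. exact: linear_sum. Qed.

Lemma invertible_neumann T : `|T| < 1 -> invertible (1 - T).
Proof. exact: neumann. Qed.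

Lemma endo_normM S T : `|S * T| <= `|S| * `|T|.
Proof. exact: (@banach_normM R[i] (endo X)). Qed.

(** The norm of f need not be attained, so u is only asked to reach half of it, whence the factor
    2. *)
Lemma dual_almost_norming f : (exists x, f x != 0) ->
  exists u, [/\ `|u| = 1, f u != 0 & forall y, `|f y| <= 2 * `|f u| * `|y|].
Proof.
move=> [x fx].
have s0 : 0 < opnorm f.
  rewrite lt_neqAle opnorm_ge0 andbT eq_sym; apply: contra fx => /eqP s0.
  by rewrite -normr_le0 (le_trans (le_opnorm f x))// s0 mul0r.
have [u fu] : exists u, opnorm f / 2 * `|u| < `|f u|.
  apply: contrapT => nu.
  suff : opnorm f <= opnorm f / 2.
    by rewrite ler_pdivlMr// mulr_natr mulr2n gerDl => /(lt_le_trans s0); rewrite ltxx.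
  apply: opnorm_le => [|y]; first by rewrite divr_ge0// ltW.
  have sr : opnorm f / 2 * `|y| \is Num.real.
    by rewrite realM ?normr_real// gtr0_real// divr_gt0.
  rewrite (real_leNgt (normr_real _) sr).
  by apply/negP => fy; apply: nu; exists y.
have u0 : 0 < `|u|.
  rewrite normr_gt0; apply: contraTneq fu => ->.
  by rewrite linear0 !normr0 mulr0 ltxx.
have fu0 : f u != 0.
  rewrite -normr_gt0; apply: le_lt_trans fu.
  by rewrite mulr_ge0// divr_ge0// ltW.
exists (`|u|^-1 *: u); rewrite linearZ/= !normrZ ger0_norm ?invr_ge0//; split.
- by rewrite mulVf// gt_eqF.
- by rewrite mulf_neq0// invr_neq0// gt_eqF.
move=> y; rewrite (le_trans (le_opnorm f y))// ler_wpM2r// -ler_pdivrMl//.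
by rewrite mulrC [leRHS]mulrC ler_pdivlMr// ltW.
Qed.

(** The Sherman-Morrison formula: the inverse subtracts [(1 + h u)^-1] times the same rank-one
    operator. *)
Lemma invertible_rank1 u h : 1 + h u != 0 -> invertible (1 + rank1 u h).
Proof.
move=> hu; pose c := (1 + h u)^-1 : R[i]; exists (1 - c *: rank1 u h).
have LE y : (1 + rank1 u h) y = y + h y *: u by rewrite endo_addE rank1E.
have ME y : (1 - c *: rank1 u h) y = y - (c * h y) *: u.
  by rewrite endo_addE -scalerA -(rank1E u h y).
have cE : c * h u = 1 - c by rewrite -[X in _ = X - _](mulVf hu) -/c; ring.
split; apply: operator_ext => y; rewrite endoME.
  rewrite LE ME functionalB functionalZ -scaleNr -addrA -scalerDl.
  rewrite (_ : - _ + _ = 0) ?scale0r ?addr0// [c * _ * _]mulrAC cE.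
  by ring.
rewrite ME LE functionalD functionalZ -addrA -scalerBl.
rewrite (_ : _ - _ = 0) ?scale0r ?addr0// mulrDr mulrCA cE.
by ring.
Qed.

(* The new direction is sent to a vector u almost norming h \o A^-1, that is,
   uniformly far from the hyperplane A (ker h). *)
Lemma finproj_correction P : finproj P -> forall c : R[i], 0 < c ->
  exists2 d : R[i], 0 < d & forall A, invertible A ->
    (forall y, P y = 0 -> c * `|y| <= `|A y|) ->
    exists B : endo X, [/\ invertible B, forall y, P y = 0 -> B y = A y &
                  forall y, d * `|y| <= `|B y|].
Proof.
elim=> [c c0|{}P x h Pf IH Px x1 hx hP c c0].
  by exists c => // A AI Ac; exists A; split=> // y; exact: Ac.
(* With m the component of y in the smaller kernel, |h y| <= 2 |A1 y| since u almost norms phi. So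
   |A m| <= |A1 y| + |h y| <= 3 |A1 y| and c |m| <= 3 |A1 y|, and |y| <= |m| + |h y| gives the
   constant. *)
pose c' := 3 / c + 2.
have c'0 : 0 < c' by rewrite addr_gt0// divr_gt0.
have [d d0 dP] := IH c'^-1 (etrans (invr_gt0 _) c'0).
exists d => // A [A' [AA' A'A]] Ac.
have A'AE y : A' (A y) = y by rewrite -endoME A'A.
pose phi := comp_op h A' : operator X R[i]^o.
have phiE y : phi y = h (A' y) by [].
have [|u [u1 pu phile]] := @dual_almost_norming phi.
  by exists (A x); rewrite phiE A'AE hx oner_neq0.
(* A1 agrees with A on ker h and sends x to u. The right factor is invertible because 1 + h (A' u -
   x) = phi u is nonzero. *)
pose A1 := A * (1 + rank1 (A' u - x) h).
have A1E y : A1 y = A y + h y *: (u - A x).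
  rewrite endoME endo_addE rank1E linearD linearZ linearB/=.
  by rewrite -[A (A' u)]endoME AA'.
have A1I : invertible A1.
  apply: invertibleM; first by exists A'.
  by apply: invertible_rank1; rewrite functionalB hx addrC subrK.
have kerS y : (P + rank1 x h) y = 0 <-> P y = 0 /\ h y = 0.
  by apply: finproj_kerS => //; exact: finproj_idem.
have A1ker y : P y = 0 -> h y = 0 -> A1 y = A y.
  by move=> _ hy; rewrite A1E hy scale0r addr0.
have [|B [BI BA Bd]] := dP A1 A1I.
  move=> y Py; pose m := y - h y *: x.
  have mk : (P + rank1 x h) m = 0.
    apply/kerS; rewrite functionalB functionalZ linearB linearZ/= Py Px hx scaler0 subr0.
    by rewrite mulr1 subrr.
  have yE : A1 y = A m + h y *: u.
    have -> : A m = A y - h y *: A x by rewrite linearB linearZ.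
    by rewrite A1E scalerBr addrA addrAC.
  have phiy : phi (A1 y) = h y * phi u.
    rewrite yE functionalD functionalZ phiE A'AE; have [_ ->] := (kerS m).1 mk.
    by rewrite add0r.
  have hy2 : `|h y| <= 2 * `|A1 y|.
    have := phile (A1 y); rewrite phiy normrM mulrAC ler_pM2r ?normr_gt0//.
  have My : c * `|m| <= 3 * `|A1 y|.
    rewrite (le_trans (Ac _ mk))//.
    have -> : A m = A1 y - h y *: u by rewrite yE addrK.
    rewrite (le_trans (ler_normB _ _))// normrZ u1 mulr1.
    by rewrite -[3]/(1 + 2)%:R natrD mulrDl mul1r lerD2l.
  rewrite ler_pdivrMl//.
  have -> : y = m + h y *: x by rewrite subrK.
  rewrite (le_trans (ler_normD _ _))// subrK normrZ x1 mulr1 /c' mulrDl lerD//.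
  by rewrite mulrAC ler_pdivlMr// mulrC.
exists B; split=> // y /kerS[Py hy]; rewrite BA//; exact: A1ker.
Qed.

End Fredholm.

(** * Finite-rank perturbations of the identity and their determinants *)

Section FiniteRankPerturbation.
Context (R : realType) (X : banachSpace R) (k : nat).
Context (g : 'I_k -> X) (h : 'I_k -> operator X R[i]^o).
Implicit Types (B W : 'M[R[i]]_k).

(** The coefficient matrix is kept general because the inverse of [1 - finrank_op 1%:M] has the form
    [1 + finrank_op W]. *)
Definition finrank_op B : endo X := \sum_i \sum_j B i j *: rank1 (g j) (h i).

Definition gram : 'M[R[i]]_k := \matrix_(i, j) h j (g i).

Lemma endo_sumE (I : Type) (s : seq I) (F : I -> endo X) y :
  (\sum_(i <- s) F i) y = \sum_(i <- s) F i y.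
Proof.
elim: s => [|i s IHs]; first by rewrite !big_nil.
by rewrite !big_cons endo_addE IHs.
Qed.

Lemma finrank_opE B y : finrank_op B y = \sum_i \sum_j (h i y * B i j) *: g j.
Proof.
rewrite endo_sumE; apply: eq_bigr => i _; rewrite endo_sumE; apply: eq_bigr => j _.
by rewrite -[LHS]/(B i j *: rank1 (g j) (h i) y) rank1E scalerA mulrC.
Qed.

Lemma finrank_op1E y : finrank_op 1%:M y = \sum_i h i y *: g i.
Proof.
rewrite finrank_opE; apply: eq_bigr => i _.
rewrite (bigD1 i)//= big1 ?addr0 ?mxE ?eqxx ?mulr1// => j ji.
by rewrite mxE eq_sym (negbTE ji) mulr0 scale0r.
Qed.

Lemma finrank_opB B W : finrank_op (B - W) = finrank_op B - finrank_op W.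
Proof.
rewrite -sumrB; apply: eq_bigr => i _; rewrite -sumrB; apply: eq_bigr => j _.
by rewrite !mxE scalerBl.
Qed.

Lemma finrank_opM B W : finrank_op B * finrank_op W = finrank_op (W *m gram *m B).
Proof.
apply: operator_ext => y; rewrite endoME finrank_opE [RHS]finrank_opE.
have hW i : h i (finrank_op W y) = \sum_l h l y * (W *m gram) l i.
  rewrite finrank_opE functional_sum; apply: eq_bigr => l _.
  rewrite functional_sum mxE mulr_sumr; apply: eq_bigr => j _.
  by rewrite functionalZ mxE mulrA.
under eq_bigr => i _ do under eq_bigr => j _ do rewrite hW mulr_suml scaler_suml.
under eq_bigr => i _ do rewrite exchange_big.
rewrite exchange_big; apply: eq_bigr => l _; rewrite exchange_big.
apply: eq_bigr => j _; rewrite mxE mulr_sumr scaler_suml.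
by apply: eq_bigr => i _; rewrite mulrA.
Qed.

(** A row vector v fixed by [gram] yields the vector sum_i v_i g_i fixed by the operator, and its
    values under the h i recover v. If there is none, W = (1 - gram)^-1 provides the inverse 1 +
    [finrank_op W]. *)
Lemma finrank_det : invertible (1 - finrank_op 1%:M) <-> \det (1%:M - gram) != 0.
Proof.
split=> [[V [_ VL]]|].
  apply/negP => /det0P[v v0]; rewrite mulmxBr mulmx1 => /eqP; rewrite subr_eq0 => /eqP vM.
  pose y := \sum_i v 0 i *: g i.
  have hy i : h i y = v 0 i.
    rewrite vM mxE functional_sum; apply: eq_bigr => l _.
    by rewrite functionalZ mxE.
  have Ly : (1 - finrank_op 1%:M) y = 0.
    rewrite endo_addE -[X in _ + X]/(- (finrank_op 1%:M y)) finrank_op1E.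
    under eq_bigr do rewrite hy.
    exact: subrr.
  have y0 : y = 0.
    have : (V * (1 - finrank_op 1%:M)) y = y by rewrite VL.
    by rewrite endoME Ly linear0.
  move/eqP: v0; apply; apply/rowP => i.
  by rewrite mxE -hy y0 linear0.
rewrite -unitfE -[_ \is a GRing.unit]/(_ \in unitmx) => Mu.
pose W := invmx (1%:M - gram).
have W1 : W - W *m gram = 1%:M by rewrite -{1}[W]mulmx1 -mulmxBr mulVmx.
have W2 : W - gram *m W = 1%:M by rewrite -{1}[W]mul1mx -mulmxBl mulmxV.
exists (1 + finrank_op W); split.
  by rewrite mulrDr mulr1 mulrBl mul1r finrank_opM mulmx1 -finrank_opB W1 subrK.
by rewrite mulrDl mul1r mulrBr mulr1 finrank_opM mul1mx -finrank_opB W2 subrK.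
Qed.

End FiniteRankPerturbation.

(** * Isolation of the points of non-invertibility *)

Section Isolated.
Context (R : realType) (X : banachSpace R) (T : endo X).
Hypothesis Tss : strictly_singular X X T.

(* Near q, 1 + z T is an analytic family of invertible operators minus a fixed
   finite-rank operator, so that its invertibility is decided by a determinant. *)
Lemma invertible_isolated (q : R[i]) :
  (forall e, 0 < e -> exists2 z, `|z - q| < e & invertible (1 + z *: T)) ->
  exists2 e : R[i], 0 < e &
    forall z, z != q -> `|z - q| < e -> invertible (1 + z *: T).
Proof.
have nT0 : 0 < 1 + `|T| by rewrite ltr_pwDl.
(* The lower bound on ker P needs q nonzero; near 0 a Neumann series suffices. *)
have [->|q0] := eqVneq q 0.
  move=> _; exists (1 + `|T|)^-1 => [|z _]; first by rewrite invr_gt0.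
  rewrite subr0 -[_^-1]mul1r ltr_pdivlMr// => zT.
  rewrite -[z *: T]opprK; apply: invertible_neumann.
  by rewrite normrN normrZ (le_lt_trans _ zT)// ler_wpM2l// lerDr.
move=> lim; have [P [Pf [c c0 Sc]]] := strictly_singular_bounded_below Tss q0.
set S := 1 + q *: T in Sc.
have c20 : 0 < c / 2 by rewrite divr_gt0.
have [d d0 dP] := finproj_correction Pf c20.
have nP0 : 0 < 1 + `|1 - P| by rewrite ltr_pwDl.
(* The first bound keeps S - A below c / 2, so A retains the lower bound c / 2 on ker P. The second
   makes B^-1 (S - A) (1 - P) smaller than 1; it can be imposed before A is known because d is
   independent of A. *)
have [e [e0 ec ed]] := pos_lower_bound (divr_gt0 c20 nT0)
  (divr_gt0 (divr_gt0 d0 nP0) nT0).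
have [z zq AI] := lim e e0; set A := 1 + z *: T in AI.
have SA : S - A = (q - z) *: T by rewrite /S /A opprD addrACA subrr add0r -scalerBl.
have zT : `|z - q| * `|T| < c / 2.
  apply: (@le_lt_trans _ _ (`|z - q| * (1 + `|T|))); first by rewrite ler_wpM2l// lerDr.
  by rewrite -ltr_pdivlMr// (lt_le_trans zq).
have SAy y : `|(S - A) y| <= c / 2 * `|y|.
  rewrite SA (le_trans (le_endo_norm _ _))// ler_wpM2r// normrZ distrC.
  exact: ltW.
have [|B [[B' [BB' B'B]] BA Bd]] := dP A AI.
  move=> y Py; have -> : A y = S y - (S - A) y by rewrite endo_addE opprD addNKr opprK.
  rewrite (le_trans _ (lerB_dist _ _))// lerBrDr (le_trans _ (Sc y Py))//.
  by rewrite [in leRHS](splitr c) mulrDl lerD2l.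
have nB' : `|B'| <= d^-1.
  apply: opnorm_le => [|y]; first by rewrite invr_ge0 ltW.
  rewrite ler_pdivlMl// (le_trans (Bd _))// -endoME BB'//.
(* G equals S on ker P, where B = A, and B on the range of P. It is thus a finite-rank perturbation
   of S and at the same time a small perturbation of B. *)
pose G := B + (S - A) * (1 - P).
have GI : invertible G.
  have -> : G = B * (1 - - (B' * ((S - A) * (1 - P)))).
    by rewrite opprK mulrDr mulr1 mulrA BB' mul1r.
  apply: invertibleM; first by exists B'.
  apply: invertible_neumann; rewrite normrN (le_lt_trans (endo_normM _ _))//.
  rewrite (le_lt_trans (ler_wpM2r _ nB'))// ltr_pdivrMl// mulr1.
  rewrite (le_lt_trans (endo_normM _ _))// SA normrZ distrC.
  apply: (@le_lt_trans _ _ (`|z - q| * (1 + `|T|) * (1 + `|1 - P|))).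
    by apply: ler_pM; rewrite ?mulr_ge0// ?ler_wpM2l// ?lerDr.
  by rewrite -ltr_pdivlMr// -ltr_pdivlMr// (lt_le_trans zq).
have GE : G = S + (B - S) * P.
  apply: operator_ext => y; rewrite /G.
  have PE : (1 - P) y = y - P y by [].
  have BE : B (y - P y) = A (y - P y).
    by apply: BA; rewrite [LHS]linearB/= finproj_idem// subrr.
  have SE : S (y - P y) = S y - S (P y) by rewrite linearB.
  have BBE : B (y - P y) = B y - B (P y) by rewrite linearB.
  rewrite endo_addE endoME PE -[(S - A) _]/(S (y - P y) - A (y - P y)) -BE.
  rewrite [RHS]endo_addE endoME -[(B - S) _]/(B (P y) - S (P y)) SE BBE opprB.
  by rewrite addrCA [B y + _]addrC subrK -addrA [- _ + _]addrC.
have [k [xs [hs PE]]] := finproj_sum Pf.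
have [G' [GG' G'G]] := GI; pose D := - (G' * T).
pose r := (2 * (1 + `|G'| * `|T|))^-1.
have gt0 : 0 < 1 + `|G'| * `|T| by rewrite ltr_pwDl// mulr_ge0.
have r0 : 0 < r by rewrite invr_gt0 mulr_gt0.
have wD w : `|w| < r -> `|w *: D| <= 2^-1.
  move=> wr; rewrite normrZ normrN -[leRHS]mul1r ler_pdivlMr// mulrC.
  apply: (@le_trans _ _ (2 * (`|w| * (1 + `|G'| * `|T|)))).
    by rewrite !ler_wpM2l// (le_trans (endo_normM _ _))// lerDr.
  move: wr; rewrite /r -[_^-1]mul1r ltr_pdivlMr ?mulr_gt0// mulrCA => /ltW.
  by [].
have /choice[H HP] : forall w, exists H : endo X, `|w| < r ->
    (G + w *: T) * H = 1 /\ H * (G + w *: T) = 1.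
  move=> w; have [wr|] := pselect (`|w| < r); last by exists 0.
  suff [H HE] : invertible (G + w *: T) by exists H.
  have -> : G + w *: T = G * (1 - w *: D).
    by rewrite mulrBr mulr1 -scalerAr mulrN mulrA GG' mul1r scalerN opprK.
  apply: invertibleM => //; apply: invertible_neumann.
  by rewrite (le_lt_trans (wD _ wr))// invf_lt1 ?ltr1n.
(* The resolvent identity for G + w T = G (1 - w D). Iterated, it shows that the n-th Taylor
   remainder of H is [D ^+ n * H w]. *)
have HE w : `|w| < r -> H w = G' + w *: (D * H w).
  move=> wr; have [/(congr1 (fun Q => G' * Q)) E _] := HP w wr.
  move: E; rewrite mulr1 mulrA mulrDr G'G mulrDl mul1r -scalerAr -scalerAl => <-.
  by rewrite /D mulNr scalerN addrK.
have nH w : `|w| < r -> `|H w| <= 2 * `|G'|.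
  move=> wr; have : `|H w| <= `|G'| + 2^-1 * `|H w|.
    rewrite {1}HE// (le_trans (ler_normD _ _))// lerD2l scalerAl.
    by rewrite (le_trans (endo_normM _ _))// ler_wpM2r// wD.
  rewrite -lerBlDr -{1}[`|H w|]mul1r -mulrBl (_ : 1 - 2^-1 = 2^-1); last by field.
  by rewrite ler_pdivrMl.
pose b i := (B - S) (xs i).
(* This is H w (B - S) P, so that S + w T = (G + w T) (1 - L w), and only 1 - L w can fail to be
   invertible. *)
pose L w := finrank_op (fun i => H w (b i)) hs 1%:M.
have SL w : `|w| < r -> S + w *: T = (G + w *: T) * (1 - L w).
  move=> wr; have [GH _] := HP w wr.
  have -> : L w = H w * ((B - S) * P).
    apply: operator_ext => y; rewrite finrank_op1E !endoME PE !linear_sum.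
    by apply: eq_bigr => i _; rewrite !linearZ.
  by rewrite mulrBr mulr1 !mulrA GH mul1r GE [RHS]addrAC addrK.
have good w : `|w| < r -> invertible (S + w *: T) <->
    \det (1%:M - gram (fun i => H w (b i)) hs) != 0.
  move=> wr; have [GH HG] := HP w wr; rewrite -finrank_det -/(L w) SL//.
  split=> [GL|]; last by apply: invertibleM; exists (H w).
  have -> : 1 - L w = H w * ((G + w *: T) * (1 - L w)) by rewrite mulrA HG mul1r.
  by apply: invertibleM => //; exists (G + w *: T).
have zE z0 : 1 + z0 *: T = S + (z0 - q) *: T.
  by rewrite /S -addrA -scalerDl [q + _]addrC subrK.
have [||e1 e10 e1P] := @analytic_isolated_zeros R r
    (fun w => \det (1%:M - gram (fun i => H w (b i)) hs)) r0.
- apply: analytic_det => // i j.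
  rewrite (_ : (fun _ => _) = (fun w => (i == j)%:R + (-1) * hs j (H w (b i)))); last first.
    by apply/funext => v; rewrite !mxE mulN1r.
  apply: analyticD; first exact: analytic_cst.
  apply: analyticM => //; first exact: analytic_cst.
  exists (opnorm (hs j) * (`|1 : endo X| * (2 * `|G'|) * `|b i|)), `|D|,
    (fun n w => hs j ((D ^+ n * H w) (b i))); split.
  + by rewrite !mulr_ge0// opnorm_ge0.
  + exact: normr_ge0.
  + move=> n w wr; rewrite (le_trans (le_opnorm _ _))// -[leRHS]mulrA ler_wpM2l ?opnorm_ge0//.
    rewrite (le_trans (le_endo_norm _ _))// [leRHS]mulrAC ler_wpM2r//.
    rewrite (le_trans (endo_normM _ _))// [leRHS]mulrAC ler_pM ?nH//.
    exact: (@banach_normX R (endo X)).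
  + move=> n w wr; have H0 : H 0 = G' by rewrite HE ?normr0// scale0r addr0.
    rewrite {1}HE// H0 mulrDr -scalerAr mulrA -exprSr endo_addE functionalD; congr (_ + _).
    exact: functionalZ.
  + by apply/funext => v; rewrite mul1r.
(* The hypothesis on q enters a second time: good points near q are zeros of no determinant, so the
   latter is not identically 0 near 0. *)
- move=> e' e'0; have [e2 [e20 e2e e2r]] := pos_lower_bound e'0 r0.
  have [z0 z0q zI] := lim _ e20; exists (z0 - q); first exact: lt_le_trans e2e.
  by apply/good; [exact: lt_le_trans e2r|rewrite -zE].
have [e2 [e20 e2e e2r]] := pos_lower_bound e10 r0.
exists e2 => // z0 zq0 z0e; rewrite zE; apply/good; first exact: lt_le_trans e2r.
by apply: e1P; [rewrite subr_eq0|exact: lt_le_trans e2e].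
Qed.

End Isolated.

(** * Arcs avoiding isolated bad points *)

Section AvoidingCurve.
Context (R : realType) (good : set R[i]).
Hypothesis good0 : good 0.
Hypothesis good_isolated : forall q,
  (forall e, 0 < e -> exists2 z, `|z - q| < e & good z) ->
  exists2 e : R[i], 0 < e & forall z, z != q -> `|z - q| < e -> good z.

Definition parabola (s t : R) : R[i] := t +i* (s * (t * (1 - t))).

Let parabola_dist s t u : 0 < s -> 0 <= t -> t <= 1 -> `|parabola s t - u%:C| <= (`|t - u| + s)%:C.
Proof.
move=> s0 t0 t1; rewrite (_ : parabola s t - u%:C = (t - u) +i* (s * (t * (1 - t)))).
  rewrite (le_trans (normc_le_D _ _))// lecR lerD2l ger0_norm.
    by rewrite -[leRHS]mulr1 ler_wpM2l ?(ltW s0)// mulr_ile1 ?subr_ge0// gerBl.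
  by rewrite !mulr_ge0 ?subr_ge0// ltW.
by apply/eqP; rewrite eq_complex/= subr0 !eqxx.
Qed.

(* The arcs with small s > 0 approach the segment [0, 1], and near each of its
   points only that point can be bad. *)
Lemma exists_good_parabola : exists s : R, forall t, 0 <= t -> t < 1 -> good (parabola s t).
Proof.
(* All sufficiently flat arcs are asked to be good up to t: uniformity in s makes the arcs
   accumulate at real points, where isolation is then applied. *)
pose Q (t : R) := exists2 d : R, 0 < d & forall s u, 0 < s -> s < d ->
  0 <= u -> u < t -> good (parabola s u).
suff [d d0 dP] : Q 1.
  by exists (d / 2) => t t0 t1; apply: dP; rewrite ?divr_gt0// ltr_pdivrMr// ltr_pMr// ltr1n.
pose E := [set t : R | [/\ 0 <= t, t <= 1 & Q t]].
have E0 : E 0 by split=> //; exists 1 => // s u _ _ u0; rewrite ltNge u0.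
have Esup : has_sup E by split; [exists 0|exists 1 => t []].
pose tau := sup E.
have tau0 : 0 <= tau by apply: sup_upper_bound.
have tau1 : tau <= 1 by apply: ge_sup => [|t []//]; exists 0.
have [e e0 eP] : exists2 e : R[i], 0 < e &
    forall z, z != tau%:C -> `|z - tau%:C| < e -> good z.
  apply: good_isolated => e e0; have er := RRe_real (gtr0_real e0).
  have re0 : 0 < complex.Re e by rewrite -ltcR er.
  move: tau0; rewrite le_eqVlt => /orP[/eqP <-|tpos].
    by exists 0 => //; rewrite subrr normr0.
  pose m := Num.min tau (complex.Re e / 2).
  have m0 : 0 < m by rewrite lt_min tpos divr_gt0.
  have [t [t0 t1 [d d0 dP]] tt] := sup_adherent m0 Esup.
  have tle : t <= tau by apply: sup_upper_bound => //; split=> //; exists d.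
  have mt : m <= tau by rewrite ge_min lexx.
  have me : m <= complex.Re e / 2 by rewrite ge_min lexx orbT.
  (* A parameter below t, hence on the good part of the arc, yet within m of tau; m <= tau keeps it
     nonnegative. *)
  pose u := ((tau - m) + t) / 2.
  pose s := Num.min (d / 2) (complex.Re e / 4).
  have s0 : 0 < s by rewrite lt_min !divr_gt0.
  have sd : s <= d / 2 by rewrite ge_min lexx.
  have se : s <= complex.Re e / 4 by rewrite ge_min lexx orbT.
  have u0 : 0 <= u by rewrite /u -/tau in tt *; lra.
  have ut : u < t by rewrite /u; rewrite -/tau in tt; lra.
  exists (parabola s u); last by apply: dP => //; lra.
  rewrite (le_lt_trans (parabola_dist _ s0 u0 _))//; first by lra.
  rewrite -er ltcR distrC ger0_norm; last by lra.
  by rewrite /u; rewrite -/tau in tt; lra.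
have er := RRe_real (gtr0_real e0).
have re0 : 0 < complex.Re e by rewrite -ltcR er.
have re2 : 0 < complex.Re e / 2 by rewrite divr_gt0.
have [t [t0 t1 [d d0 dP]] tt] := sup_adherent re2 Esup.
rewrite -/tau in tt.
(* Goodness is pushed past tau, as far as 1 allows; since tau is the supremum, this forces t2 =
   1. *)
pose t2 := Num.min 1 (tau + complex.Re e / 2).
have t21 : t2 <= 1 by rewrite ge_min lexx.
have t2e : t2 <= tau + complex.Re e / 2 by rewrite ge_min lexx orbT.
have Qt2 : Q t2.
  exists (Num.min d (complex.Re e / 2)); first by rewrite lt_min d0.
  move=> s u s0; rewrite lt_min => /andP[sd se] u0 ut2.
  have [ut|tu] := ltP u t; first exact: dP.
  have u1 : u < 1 by lra.
  move: u0; rewrite le_eqVlt => /orP[/eqP <-|u0].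
    by rewrite /parabola mul0r mulr0.
  apply: eP.
    (* Strictly between its ends the arc has nonzero imaginary part and so misses the real point
       tau. *)
    rewrite eq_complex/= negb_and; apply/orP; right.
    by rewrite !mulf_neq0 ?gt_eqF// subr_gt0.
  rewrite (le_lt_trans (parabola_dist _ s0 (ltW u0) (ltW u1)))// -er ltcR.
  have : `|u - tau| <= complex.Re e / 2 by rewrite ler_norml; apply/andP; split; lra.
  by lra.
have Et2 : E t2.
  by split=> //; rewrite le_min ler01 addr_ge0// ltW.
have : t2 <= tau by apply: sup_upper_bound.
rewrite ge_min => /orP[h|]; last by lra.
move: Qt2; rewrite /t2; suff -> : Num.min 1 (tau + complex.Re e / 2) = 1 by [].
by apply/min_idPl; lra.
Qed.

End AvoidingCurve.

(** * The unitization of the ideal *)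

Section Unitization.
Context (R : realType) (I : closedIdeal R) (X : banachSpace R).
Hypothesis Iss : I X X `<=` strictly_singular X X.
Implicit Types (S T : endo X) (a : R[i]) (U : unitization I X).

Let IZ a S : I X X S -> I X X (a *: S).
Proof.
by move=> IS; have [I0 IP] := @ideal_subspace R I X X; have := IP a _ _ IS I0; rewrite addr0.
Qed.

Let IM S T : I X X S -> I X X (S * T).
Proof.
move=> /(ideal_comp T (id_op X)).
by rewrite (_ : comp_op _ _ = S * T)//; exact: operator_ext.
Qed.

(** Otherwise the identity would lie in the ideal and be strictly singular, although it is bounded
    below on the whole infinite-dimensional space. *)
Lemma not_ideal_invertible S : I X X S -> ~ invertible S.
Proof.
move=> IS [T [ST _]]; have := Iss (IM T IS); rewrite ST => ss1.
apply: (@banach_infinite_dim R X); apply: ss1; first by split.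
by exists 1 => // x _; rewrite mul1r.
Qed.

(** If V inverts S + a in B(X), then a is nonzero and V = a^-1 - a^-1 S V, which lies in I(X) +
    C1. *)
Lemma unitization_invertible U : invertible (val U) -> invertible U.
Proof.
have /asboolP[S [a [IS US]]] := unitizationP U.
move=> [V [UV VU]].
have a0 : a != 0.
  apply/eqP => a0; apply: (not_ideal_invertible IS); exists V.
  by move: UV VU; rewrite /= US a0 scale0r addr0.
have VP : V \in @unitization_pred R I X.
  apply/asboolP; exists (- a^-1 *: (S * V)), a^-1; split; first by apply: IZ; exact: IM.
  move: UV; rewrite /= US mulrDl -scalerAl mul1r => SV.
  have -> : S * V = 1 - a *: V by rewrite -SV addrK.
  by rewrite scaleNr scalerBr scalerA mulVf// scale1r opprB subrK.
by exists (Unitization VP); split; apply: val_inj.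
Qed.

Fact ideal_unitization S : I X X S -> S \in @unitization_pred R I X.
Proof. by move=> IS; apply/asboolP; exists S, 0; rewrite scale0r addr0. Qed.

Lemma ideal_good_parabola S : I X X S -> exists s : R, forall t, 0 <= t -> t < 1 ->
  invertible (1 + parabola s t *: S).
Proof.
move=> IS; apply: (@exists_good_parabola R [set z | invertible (1 + z *: S)]).
  by rewrite /= scale0r addr0; exact: invertible1.
exact: invertible_isolated (Iss IS).
Qed.

Lemma unitization_decomp U : exists (S : endo X) (IS : I X X S) a,
  U = Unitization (ideal_unitization IS) + a%:A.
Proof.
have /asboolP[S [a [IS US]]] := unitizationP U.
by exists S, IS, a; apply: val_inj.
Qed.

(** Joins 1 to a among the nonzero scalars. The avoidance argument is reused: at most the single
    point z = -(a - 1)^-1 is bad. *)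
Lemma scalar_path a : a != 0 -> exists s : R, forall t, 0 <= t -> t <= 1 ->
  1 + parabola s t * (a - 1) != 0.
Proof.
move=> a0; have [||s sP] := @exists_good_parabola R [set z | 1 + z * (a - 1) != 0].
- by rewrite /= mul0r addr0 oner_neq0.
- move=> q _; have [a1|a1] := eqVneq (a - 1) 0.
    by exists 1 => // z _ _; rewrite /= a1 mulr0 addr0 oner_neq0.
  have zP z : z != - (a - 1)^-1 -> 1 + z * (a - 1) != 0.
    apply: contraNneq => e; rewrite -[z](mulfK a1).
    have -> : z * (a - 1) = -1 by apply/eqP; rewrite -addr_eq0 addrC e.
    by rewrite mulN1r.
  have [qE|qn] := eqVneq q (- (a - 1)^-1).
    by exists 1 => // z zq _; apply: zP; rewrite -qE.
  exists `|- (a - 1)^-1 - q|; first by rewrite normr_gt0 subr_eq0 eq_sym.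
  move=> z _ zq; apply: zP; apply: contraTneq zq => ->.
  by rewrite ltxx.
exists s => t t0; rewrite le_eqVlt => /orP[/eqP ->|]; last exact: sP.
have -> : parabola s 1 = 1 by rewrite /parabola subrr !mulr0.
by rewrite mul1r addrC subrK.
Qed.

Lemma invertibleZ (A : algType R[i]) a (x : A) : a != 0 -> invertible x -> invertible (a *: x).
Proof.
move=> a0 [y [xy yx]]; exists (a^-1 *: y).
by rewrite -!scalerAl -!scalerAr !scalerA xy yx mulfV ?mulVf// scale1r.
Qed.

Lemma parabola_continuous (s t : R) (e : R[i]) : 0 < e ->
  \forall u \near t, `|parabola s (1 - t) - parabola s (1 - u)| < e.
Proof.
have sub_cont : continuous (fun t : R => 1 - t : R).
  by move=> u; apply: cvgB; [exact: cvg_cst|exact: cvg_id].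
apply: (continuous_complex (f := fun u => 1 - u)
  (g := fun u => s * ((1 - u) * (1 - (1 - u))))) => // u.
apply: cvgMl_tmp; apply: cvgM; first exact: sub_cont.
by apply: cvgB; [exact: cvg_cst|exact: sub_cont].
Qed.

Lemma unitization_connected U : invertible U -> exists p : R -> unitization I X,
  [/\ continuous p, forall t, 0 <= t -> t <= 1 -> invertible (p t),
      p 0 = U & p 1 = 1].
Proof.
move=> UI; have [S [IS [a UE]]] := unitization_decomp U.
have a0 : a != 0.
  apply/eqP => a0; apply: (not_ideal_invertible IS); move: UI.
  rewrite UE a0 scale0r addr0 => -[V [UV VU]]; exists (val V).
  by split; [have /(congr1 val) := UV|have /(congr1 val) := VU].
have [c cP] := scalar_path a0.
have [s sP] := ideal_good_parabola (IZ a^-1 IS).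
pose W := Unitization (ideal_unitization (IZ a^-1 IS)).
have UW : U = a *: (1 + W).
  apply: val_inj; rewrite UE /= scalerDr addrC; congr (_ + _).
  by rewrite scalerA mulfV// scale1r.
(* Both factors of U = a (1 + W) move along their arcs backwards, so that the path starts at U and
   ends at 1. *)
exists (fun t => (1 + parabola c (1 - t) *: (a - 1)%:A) * (1 + parabola s (1 - t) *: W)).
have arc0 r : parabola r 0 = 0 by rewrite /parabola mul0r mulr0.
have arc1 r : parabola r 1 = 1 by rewrite /parabola subrr !mulr0.
have scE z : 1 + z *: (a - 1)%:A = (1 + z * (a - 1)) *: (1 : unitization I X).
  by rewrite scalerDl scale1r scalerA.
split.
- by apply: banach_continuousM; apply: banach_continuousD;
    try (by move=> t; exact: cvg_cst);
    apply: banach_continuousZ; exact: parabola_continuous.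
- move=> t t0 t1; rewrite scE -scalerAl mul1r; apply: invertibleZ.
    by apply: cP; rewrite ?subr_ge0// gerBl.
  (* At t = 0 the operator factor is at the end of its arc that [sP] leaves out; there it is a
     nonzero multiple of U. *)
  move: t0; rewrite le_eqVlt => /orP[/eqP <-|t0].
    rewrite subr0 arc1 scale1r -[1 + W]scale1r -(mulVf a0) -scalerA -UW.
    by apply: invertibleZ UI; rewrite invr_eq0.
  apply: unitization_invertible; apply: sP; rewrite ?subr_ge0//.
  by rewrite gtrBl.
- by rewrite subr0 !arc1 scE scale1r mul1r [1 + (a - 1)]addrC subrK -scalerAl mul1r -UW.
- by rewrite subrr !arc0 !scale0r !addr0 mulr1.
Qed.

(** Two moves, each costing less than e / 2: the scalar part a is made nonzero, and the ideal part
    is multiplied by a point of a good arc just before its end 1. *)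
Lemma unitization_dense U (e : R[i]) : 0 < e ->
  exists2 V : unitization I X, invertible V & banach_norm (V - U) < e.
Proof.
move=> e0; have [S [IS [a UE]]] := unitization_decomp U.
set W := Unitization _ in UE.
have [b b0 ab] : exists2 b : R[i], b != 0 & `|b - a| * banach_norm (1 : unitization I X) < e / 2.
  have n0 : 0 < 1 + banach_norm (1 : unitization I X).
    by rewrite ltr_pwDl// banach_norm_ge0.
  have [a0|a0] := eqVneq a 0; last first.
    by exists a => //; rewrite subrr normr0 mul0r divr_gt0.
  pose b := e / 2 / (1 + banach_norm (1 : unitization I X)).
  have b0 : 0 < b by rewrite !divr_gt0.
  exists b; first by rewrite gt_eqF.
  rewrite a0 subr0 gtr0_norm// /b mulrAC ltr_pdivrMr// ltr_pM2l ?divr_gt0//.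
  by rewrite ltrDr.
have [s sP] := ideal_good_parabola (IZ b^-1 IS).
have n0 : 0 < 1 + banach_norm W by rewrite ltr_pwDl// banach_norm_ge0.
pose d := e / 2 / (1 + banach_norm W).
have d0 : 0 < d by rewrite !divr_gt0.
have [t [t0 t1 td]] : exists t, [/\ 0 <= t, t < 1 & `|parabola s t - 1| < d].
  have := parabola_continuous s 0 d0; rewrite subr0.
  have -> : parabola s 1 = 1 by rewrite /parabola subrr !mulr0.
  move=> /nbhs_ballP[r /= r0 rP].
  pose u := Num.min 1 (r / 2); have u0 : 0 < u by rewrite lt_min ltr01 divr_gt0.
  exists (1 - u); split; first by rewrite subr_ge0 ge_min lexx.
    by rewrite gtrBl.
  rewrite distrC; apply: rP; rewrite -ball_normE /ball_/= sub0r normrN gtr0_norm//.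
  by rewrite gt_min ltr_pdivrMr// ltr_pMr// ltr1n orbT.
exists (b *: (1 + parabola s t *: (b^-1 *: W))).
  apply: invertibleZ => //; apply: unitization_invertible.
  exact: sP.
rewrite UE scalerDr !scalerA [b * _ * _]mulrAC mulfV// mul1r.
have -> : b *: 1 + parabola s t *: W - (W + a%:A) = (b - a)%:A + (parabola s t - 1) *: W.
  by rewrite !scalerBl scale1r opprD [- W - _]addrC addrACA.
rewrite (le_lt_trans (banach_normD _ _))// !banach_normZ [ltRHS]splitr ltrD//.
apply: (@le_lt_trans _ _ (`|parabola s t - 1| * (1 + banach_norm W))).
  by rewrite ler_wpM2l// lerDr.
by rewrite -ltr_pdivlMr.
Qed.

End Unitization.

Theorem corollary3p3 (R : realType) (X : banachSpace R) (I : closedIdeal R)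
    (I_nonzero : nonzero_ideal I)
    (I_strictly_singular : forall Y Z : banachSpace R,
        I Y Z `<=` strictly_singular Y Z) :
  K1_ideal I X = [set K1_ideal_zero I X].
Proof.
apply: K1_trivial => [U e|U].
  exact: unitization_dense.
exact: unitization_connected.
Qed.
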